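(* Let $\mathcal{C}:f=0$ be a conic-line arrangement in $\mathbb{P}^2$ (over $\mathbb{C}$) and let $d_1\leq d_2$ be the two smallest degrees of a minimal system of homogeneous generators for the module of Jacobian syzygies $D_0(f)$. If $d_2\leq \deg(\mathcal{C})-2$, then $$0\leq t(\mathcal{C})\leq \deg(\mathcal{C})-3.$$ Conversely, for any integers $t$ and $d$ such that $0\leq t\leq d-3$, there are conic-line arrangements $\mathcal{C}$ in $\mathbb{P}^2$ containing at least one conic such that $t(\mathcal{C})=t$ and $\deg(\mathcal{C})=d$. In particular, for any degree $d\geq 3$, there are free conic-line arrangements $\mathcal{C}$ containing at least one conic such that $\deg(\mathcal{C})=d$.
   Context: A conic-line arrangement is a finite collection of distinct lines and smooth conics in $\mathbb{P}^2=\mathbb{P}^2_{\mathbb{C}}$, identified with the reduced curve given by their union; its degree is the degree of this curve. Let $S=\mathbb{C}[x,y,z]$ with its standard grading. For a reduced curve $C:f=0$ of degree $d$ in $\mathbb{P}^2$, let $$D_0(f)=\{(a,b,c)\in S^3 : af_x+bf_y+cf_z=0\}$$ be the graded $S$-module of Jacobian syzygies, where a homogeneous element $(a,b,c)$ has degree $k$ if $a,b,c$ are homogeneous of degree $k$. If $d_1\leq d_2\leq\dots\leq d_m$ are the degrees of the elements of a minimal system of homogeneous generators of $D_0(f)$, the type of $C$ is the integer $t(C)=d_1+d_2+1-d$. The curve $C$ is free if $D_0(f)$ is a free $S$-module, equivalently $t(C)=0$. *)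

(* Defs.v *)
From HB Require Import structures.
From mathcomp Require Import all_boot all_order all_algebra.
From mathcomp Require Import complex.
From mathcomp Require Import reals.
From mathcomp Require Import mpoly.

Set Implicit Arguments.
Unset Strict Implicit.
Unset Printing Implicit Defensive.

Import Order.TTheory GRing.Theory Num.Theory.
Local Open Scope ring_scope.

Section ConicLineArrangements.

Variable K : closedFieldType.

Local Notation S := {mpoly K[3]}.

(* Plane curves are given by homogeneous equations; a point of P^2 is given by
   any nonzero vector of homogeneous coordinates v : 'I_3 -> K. *)

Definition is_line (l : S) : Prop := l \is 1.-homog /\ l != 0.

(* The Jacobian condition rules out q = 0. *)
Definition is_smooth_conic (q : S) : Prop :=
  q \is 2.-homog /\
  forall v : 'I_3 -> K,
    (exists i, v i != 0) -> q.@[v] = 0 -> exists i, (mderiv i q).@[v] != 0.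

(* The origin may be included here: it is a zero of every homogeneous
   polynomial of positive degree. *)
Definition same_locus (p q : S) : Prop :=
  forall v : 'I_3 -> K, p.@[v] = 0 <-> q.@[v] = 0.

Record conic_line_arrangement := ConicLineArrangement {
  ncomponents : nat;
  component : 'I_ncomponents -> S;
  componentP : forall i, is_line (component i) \/ is_smooth_conic (component i);
  component_distinct :
    forall i j, i != j -> ~ same_locus (component i) (component j)
}.

(* The components are distinct and irreducible, so this product is a reduced
   equation of their union; if there is at least one component, rescaling its
   equation yields every other equation of the same curve. *)
Definition equation (A : conic_line_arrangement) : S :=
  \prod_(i < ncomponents A) component i.

Definition has_conic (A : conic_line_arrangement) : Prop :=
  exists i : 'I_(ncomponents A), is_smooth_conic (component i).

(* msize is one more than the total degree of a nonzero polynomial. *)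
Definition curve_degree (f : S) : nat := (msize f).-1.

(* D_0(f), as a predicate on the S-module S^3 of row vectors. *)
Definition jacobian_syzygy (f : S) (g : 'rV[S]_3) : Prop :=
  \sum_(i < 3) g 0 i * mderiv i f = 0.

Definition homogeneous_of_degree (k : nat) (g : 'rV[S]_3) : Prop :=
  forall i, g 0 i \is k.-homog.

Definition generates (D : 'rV[S]_3 -> Prop) (m : nat) (G : 'I_m -> 'rV[S]_3)
    (J : {set 'I_m}) : Prop :=
  forall g, D g -> exists c : 'I_m -> S, g = \sum_(i in J) c i *: G i.

(* ds is the nondecreasing list of degrees of a minimal (irredundant) system
   of homogeneous generators of D_0(f); D_0(f) is a graded module, so ds is
   determined by f. *)
Definition minimal_syzygy_degrees (f : S) (ds : seq nat) : Prop :=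
  sorted leq ds /\
  exists G : 'I_(size ds) -> 'rV[S]_3,
    [/\ forall i, jacobian_syzygy f (G i),
        forall i : 'I_(size ds), homogeneous_of_degree (nth 0%N ds i) (G i),
        generates (jacobian_syzygy f) G [set: 'I_(size ds)] &
        forall J : {set 'I_(size ds)},
          generates (jacobian_syzygy f) G J -> J = [set: 'I_(size ds)]].

Definition two_smallest_degrees (f : S) (d1 d2 : nat) : Prop :=
  exists ds, minimal_syzygy_degrees f [:: d1, d2 & ds].

Definition type_of_degrees (f : S) (d1 d2 : nat) : int :=
  d1%:Z + d2%:Z + 1 - (curve_degree f)%:Z.

Definition has_type (f : S) (t : int) : Prop :=
  exists d1 d2, two_smallest_degrees f d1 d2 /\ t = type_of_degrees f d1 d2.

(* D_0(f) has a finite S-basis, not required to be homogeneous. *)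
Definition free_curve (f : S) : Prop :=
  exists (m : nat) (B : 'I_m -> 'rV[S]_3),
    [/\ forall i, jacobian_syzygy f (B i),
        generates (jacobian_syzygy f) B [set: 'I_m] &
        forall c : 'I_m -> S,
          \sum_(i < m) c i *: B i = 0 -> forall i, c i = 0].

End ConicLineArrangements.

(* Main.v *)
Require Import Defs.
From mathcomp Require Import all_boot all_order all_algebra.
From mathcomp Require Import complex.
From mathcomp Require Import reals.
From mathcomp Require Import mpoly.
From mathcomp Require Import ring zify boolp.

(** The bounds. The upper bound only uses d1 <= d2 <= d - 2. The lower bound says
    that d1 + d2 >= d - 1. Let G and H be the first two generators. Their cross
    product and the gradient of f are both orthogonal to G and H, hence
    proportional; combined with the relation of Euler this shows that every
    component of the arrangement divides the determinant of G, H and (x, y, z)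
    ([component_divides_determinant]). The components are distinct primes, so f
    divides this determinant, which has degree d1 + d2 + 1
    ([determinant_degree]). The determinant is nonzero because two generators
    of a minimal system, the first being of least degree, are not parallel:
    otherwise both would be multiples of a common vector, again a syzygy, and
    the second one would be redundant ([minimal_generators_not_parallel]).
    This, and the primality of lines and smooth conics, rests on the existence
    of greatest common divisors of polynomials, expressed by saying that the
    solutions of a v = b u form a cyclic module and propagated from R to R[X]
    by the lemma of Gauss ([cyclic_relations_poly]).

    The examples. Their components are the conic q = 2 x^2 + y z, lines of the
    pencil through (1 : 0 : 0), from which q has the tangents y = 0 and z = 0, and
    n lines a x + a^2 y + z = 0. A vector field g on the affine space has a radial part
    y g_z - z g_y, which vanishes identically when g preserves every line of the
    pencil. The syzygies with zero radial part are the multiples of a single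
    one, of degree n + 2 ([radial_eq0]), and the lines of the pencil that belong
    to the arrangement divide the radial part of every syzygy.

    For type 0 and degree at least 4 there are no transversal lines (n = 0) and
    both tangents belong to the arrangement: the torus field preserving q, y
    and z, multiplied by the other lines, has as radial part the product of all
    lines, so that it forms a basis of the syzygies with the previous field
    ([free_family_free]). The conic with one tangent is the case of degree 3.

    For type t > 0 take n = t - 1, the tangent y = 0 and at least one more
    line of the pencil. On a transversal line a syzygy becomes a planar field
    preserving the d - 1 distinct points cut out by the other components, so its
    radial part is there a multiple of the product of these components
    ([radial_on_line]). One explicit field for each transversal line takes
    this multiple away; what remains is c f / q, and the tangency of q with z = 0
    forces c to vanish at (0 : 1 : 0), so that two more fields suffice
    ([family_generates]). The generators have degrees n + 2, d - 2, ..., d - 2,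
    and they are irredundant because their radial parts are linearly
    independent ([family_radials_independent]); the type is
    n + 2 + d - 2 + 1 - d = t. *)

Set Implicit Arguments.
Unset Strict Implicit.
Unset Printing Implicit Defensive.

Import Order.TTheory GRing.Theory Num.Theory.
Local Open Scope ring_scope.

(** * Greatest common divisors of polynomials *)

Definition divides (R : comNzRingType) (p q : R) : Prop := exists r, q = r * p.

Definition prime_element (R : idomainType) (p : R) : Prop :=
  [/\ p != 0, p \isn't a GRing.unit &
      forall a b, divides p (a * b) -> divides p a \/ divides p b].

(** For a and b this module is generated by the quotients of a and b by their
    greatest common divisor, so the property expresses the existence of such
    divisors. *)
Definition cyclic_relations (R : idomainType) : Prop :=
  forall a b : R, a != 0 -> exists a' b',
    [/\ a' != 0, a * b' = b * a' &
        forall u v, a * v = b * u -> exists h, u = h * a' /\ v = h * b'].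

Lemma cyclic_relations_field (K : fieldType) : cyclic_relations K.
Proof.
move=> a b a0; exists 1, (b / a); rewrite oner_eq0; split=> //.
  by rewrite mulr1 mulrC divfK.
move=> u v e; exists u; rewrite mulr1; split=> //.
by apply: (mulfI a0); rewrite e mulrA mulrCA; field.
Qed.

Section GaussLemma.

Variable R : idomainType.
Hypothesis relR : cyclic_relations R.

(** Triviality of the content, stated without a greatest common divisor. *)
Definition primitive (F : nat -> R) : Prop :=
  forall s t, s != 0 -> (forall i, divides s (t * F i)) -> divides s t.

(** Once the tail is c times a primitive sequence, dividing the head and c by
    their greatest common divisor makes the whole sequence primitive. *)
Lemma content_seq (l : seq R) : (exists i, l`_i != 0) ->
  exists c (l' : seq R),
    [/\ c != 0, forall i, l`_i = c * l'`_i & primitive (nth 0 l')].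
Proof.
elim: l => [|x l IH] [m].
  by rewrite nth_nil eqxx.
have [/hasP[y yl y0] _|/hasPn l0] := boolP (has (fun y => y != 0) l); last first.
  have {}l0 j : l`_j = 0.
    have [jl|/(nth_default _) -> //] := ltnP j (size l).
    by apply/eqP/negPn/l0/mem_nth.
  case: m => [|m] /=; last by rewrite l0 eqxx.
  move=> x0; exists x, [:: 1]; split=> //.
    by case=> [|k] /=; rewrite ?mulr1 ?l0 ?nth_nil ?mulr0.
  by move=> s t s0 /(_ 0%N); rewrite mulr1.
case: IH => [|c [l' [c0 lE l'P]]]; first by exists (index y l); rewrite nth_index.
have [c' [x' [c'0 cx' gen]]] := relR x c0.
have [g [cg xg]] := gen c x (mulrC _ _).
have nthE j : [seq c' * z | z <- l']`_j = c' * l'`_j.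
  have [jl|jl] := ltnP j (size l'); first by rewrite (nth_map 0).
  by rewrite !nth_default ?mulr0 ?size_map.
exists g, (x' :: [seq c' * z | z <- l']); split.
- by apply: contraNneq c0 => g0; rewrite cg g0 mul0r.
- by case=> [|j] //=; rewrite nthE lE cg mulrA.
move=> s t s0 H.
have [k1 k1E] : divides s (t * x') := H 0%N.
have [k2 k2E] : divides s (t * c').
  by apply: l'P => // j; have := H j.+1; rewrite /= nthE mulrA.
have [|h [h1 h2]] := gen k2 k1.
  apply: (mulIf s0).
  by rewrite -[RHS]mulrA -k2E -mulrA -k1E mulrCA cx'; ring.
exists h; apply: (mulIf c'0); rewrite k2E h1; ring.
Qed.

Lemma content_poly (u : {poly R}) : u != 0 ->
  exists c (u' : {poly R}), [/\ c != 0, u = c *: u' & primitive (nth 0 u')].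
Proof.
move=> u0.
have [|c [l [c0 uE lP]]] := @content_seq u.
  by exists (size u).-1; rewrite -lead_coefE lead_coef_eq0.
exists c, (Poly l); split=> //.
  by apply/polyP => i; rewrite coefZ coef_Poly uE.
by move=> s t s0 H; apply: lP => // i; have := H i; rewrite coef_Poly.
Qed.

Lemma coef_dividesP (s : R) (h : {poly R}) :
  (forall i, divides s h`_i) -> exists h', h = s *: h'.
Proof.
elim/poly_ind: h => [_|h c IH H]; first by exists 0; rewrite scaler0.
have [|h' ->] := IH.
  by move=> i; have := H i.+1; rewrite coefD coefMX coefC addr0.
have [c' c'E] := H 0%N; rewrite coefD coefMX coefC add0r in c'E.
exists (h' * 'X + c'%:P).
by rewrite c'E scalerDr -scalerAl -!mul_polyC -polyCM [s * c']mulrC.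
Qed.

(** The argument of McCoy on zero divisors, read modulo s. Going down the
    coefficients of u, s divides u_j times the leading coefficient of h; hence
    u_j h deprived of its leading term is a multiplier of smaller degree, to
    which induction applies. So s divides all products u_j h_i, and u is
    primitive. *)
Lemma gauss (u : {poly R}) (s : R) (h : {poly R}) :
  primitive (nth 0 u) -> s != 0 ->
  (forall i, divides s (h * u)`_i) -> forall i, divides s h`_i.
Proof.
move=> uP s0; have [n] := ubnP (size h); elim: n h => // n IH h hn Hhu.
have [->|h0] := eqVneq h 0; first by move=> i; exists 0; rewrite coef0 mul0r.
suff H j i : divides s (u`_j * h`_i).
  by move=> i; apply: uP => // j; rewrite mulrC.
have [m] := ubnP (size u - j); elim: m j i => // m IHm j i ujm.
have [uj|ju] := leqP (size u) j.
  by rewrite nth_default // mul0r; exists 0; rewrite mul0r.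
pose d := (size h).-1.
have hd : size h = d.+1 by rewrite /d prednK // lt0n size_poly_eq0.
have sD a b : divides s a -> divides s b -> divides s (a + b).
  by case=> x -> [y ->]; exists (x + y); rewrite mulrDl.
have sM a b : divides s b -> divides s (a * b).
  by case=> x ->; exists (a * x); rewrite mulrA.
have s_lead : divides s (u`_j * h`_d).
  have := Hhu (d + j)%N; rewrite coefM.
  have dlt : (d < (d + j).+1)%N by lia.
  rewrite (bigD1 (Ordinal dlt)) //=.
  have -> : (d + j - d)%N = j by lia.
  set rest := \sum_(k < _ | _) _ => -[x xE].
  have [y yE] : divides s rest.
    rewrite /rest; apply: big_ind => [|a b|k kd]; [by exists 0; rewrite mul0r| exact: sD |].
    have [dk|kd'] := leqP d k.
      have dk' : (d < k)%N.
        rewrite ltn_neqAle dk andbT; apply: contra kd => /eqP e.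
        by apply/eqP/val_inj.
      by rewrite (nth_default 0) ?hd // mul0r; exists 0; rewrite mul0r.
    rewrite mulrC; apply: IHm.
    move: ujm ju kd' (ltn_ord k); rewrite -!/(is_true _); lia.
  by exists (x - y); rewrite mulrBl -xE -yE mulrC addrK.
pose h1 := u`_j *: h - (u`_j * h`_d) *: 'X^d.
have h1n : (size h1 < n)%N.
  have dn : (d.+1 <= n)%N by rewrite -hd -ltnS.
  apply: leq_trans dn.
  rewrite ltnS; apply/leq_sizeP => k dk; rewrite /h1 coefB !coefZ coefXn.
  move: dk; rewrite leq_eqVlt => /orP[/eqP <-|dk].
    by rewrite eqxx mulr1 subrr.
  have -> : h`_k = 0 by rewrite nth_default // hd.
  by rewrite gtn_eqF // !mulr0 subr0.
have := IH h1 h1n; case/(_ _ i)=> [k|x].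
  rewrite /h1 mulrBl coefB -!scalerAl !coefZ.
  apply: sD; first exact/sM/Hhu.
  rewrite -mulNr mulrC; apply: sM.
  by case: s_lead => y ->; exists (- y); rewrite mulNr.
rewrite /h1 coefB !coefZ coefXn => xE.
have -> : u`_j * h`_i = x * s + u`_j * h`_d * (i == d)%:R by rewrite -xE subrK.
by apply: sD; [exists x | rewrite mulrC; apply: sM].
Qed.

(** A solution (u0, v0) with u0 of least degree generates over the field of
    fractions. It generates over R once the contents of u0 and v0 are replaced
    by the generator of the relations between them. *)
Lemma cyclic_relations_poly : cyclic_relations {poly R}.
Proof.
move=> a b a0.
have [u0 [v0 [u0n0 uv0 umin]]] : exists u0 v0 : {poly R},
    [/\ u0 != 0, a * v0 = b * u0 &
     forall u v, a * v = b * u -> u != 0 -> (size u0 <= size u)%N].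
  have ex : exists u v, a * v = b * u /\ u != 0 by exists a, b; rewrite mulrC.
  case: ex => u; have [n] := ubnP (size u).
  elim: n u => // n IH u un [v [uv u0]].
  have [[u1 [v1 [e1 n1 s1]]]|H] := pselect (exists u1 v1,
      [/\ a * v1 = b * u1, u1 != 0 & (size u1 < size u)%N]).
    by apply: (IH u1); [exact: leq_trans s1 _ | exists v1].
  exists u, v; split=> // u1 v1 e1 n1; rewrite leqNgt; apply/negP => lt.
  by apply: H; exists u1, v1.
(* Pseudo-division by u0 solves the relation over the fraction field. *)
have quasi u v : a * v = b * u ->
    exists s h, [/\ s != 0, s *: u = h * u0 & s *: v = h * v0].
  move=> uv; set s := lead_coef u0 ^+ Pdiv.Ring.rscalp u u0.
  have s0 : s != 0 by rewrite expf_neq0 // lead_coef_eq0.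
  have e := Pdiv.ComRing.rdivp_eq u0 u.
  set h := Pdiv.Ring.rdivp u u0 in e; set r := Pdiv.Ring.rmodp u u0 in e.
  have re : a * (s *: v - h * v0) = b * r.
    have -> : r = s *: u - h * u0 by rewrite e addrC addKr.
    by rewrite !mulrBr -!scalerAr uv mulrCA uv0 mulrCA.
  have r0 : r = 0.
    apply/eqP/negPn/negP => rn0.
    by have := umin _ _ re rn0; rewrite leqNgt Pdiv.Ring.ltn_rmodp u0n0.
  exists s, h; split=> //; first by rewrite e r0 addr0.
  move: re; rewrite r0 mulr0 => /eqP; rewrite mulf_eq0 (negPf a0) /= subr_eq0.
  by move/eqP.
have [c [u1 [c0 u0E u1P]]] := content_poly u0n0.
have u1n0 : u1 != 0 by apply: contraNneq u0n0 => z; rewrite u0E z scaler0.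
have [v0z|v0n0] := eqVneq v0 0.
  have b0 : b = 0.
    move/eqP: uv0; rewrite v0z mulr0 eq_sym mulf_eq0 (negPf u0n0) orbF.
    by move/eqP.
  exists 1, 0; rewrite oner_eq0 b0 mulr0 mul0r; split=> // u v.
  move=> /eqP; rewrite mul0r mulf_eq0 (negPf a0) /= => /eqP ->.
  by exists u; rewrite mulr1 mulr0.
have [e [v1 [e0 v0E v1P]]] := content_poly v0n0.
have [c' [e' [c'0 ce' gen]]] := relR e c0.
have [g [cg eg]] := gen c e (mulrC _ _).
have g0 : g != 0 by apply: contraNneq c0 => z; rewrite cg z mul0r.
exists (c' *: u1), (e' *: v1); split.
- by rewrite -mul_polyC mulf_neq0 // polyC_eq0.
- apply: (@mulfI _ g%:P); first by rewrite polyC_eq0.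
  rewrite !mul_polyC -!scalerAr !scalerA -cg -eg.
  by rewrite scalerAr -v0E uv0 u0E scalerAr.
move=> u v /quasi[s [h [s0 su sv]]].
have [k1 k1E] : exists k, c *: h = s *: k.
  apply: coef_dividesP; apply: (gauss u1P s0) => i; exists u`_i.
  by rewrite -scalerAl scalerAr -u0E -su coefZ mulrC.
have [k2 k2E] : exists k, e *: h = s *: k.
  apply: coef_dividesP; apply: (gauss v1P s0) => i; exists v`_i.
  by rewrite -scalerAl scalerAr -v0E -sv coefZ mulrC.
have ek : e *: k1 = c *: k2.
  apply: (@mulfI _ s%:P); first by rewrite polyC_eq0.
  rewrite !mul_polyC scalerA [s * e]mulrC -scalerA -k1E scalerA [e * c]mulrC.
  by rewrite -scalerA k2E scalerA [c * s]mulrC -scalerA.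
have [k kE] : exists k, k1 = c' *: k.
  apply: coef_dividesP => i.
  have [|x [x1 x2]] := gen k1`_i k2`_i; last by exists x.
  by move/(congr1 (fun p : {poly R} => p`_i)): ek; rewrite !coefZ.
have k2E' : k2 = e' *: k.
  apply: (@mulfI _ (c%:P)); first by rewrite polyC_eq0.
  by rewrite !mul_polyC -ek kE !scalerA ce'.
exists k; split; apply: (@mulfI _ s%:P); rewrite ?polyC_eq0 //.
  by rewrite !mul_polyC su u0E -scalerAr scalerAl k1E -scalerAl kE -scalerAl -scalerAr.
by rewrite !mul_polyC sv v0E -scalerAr scalerAl k2E -scalerAl k2E' -scalerAl -scalerAr.
Qed.

End GaussLemma.

Lemma cyclic_relations_iso (A B : idomainType) (f : {rmorphism A -> B})
    (g : B -> A) : cancel f g -> cancel g f ->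
  cyclic_relations B -> cyclic_relations A.
Proof.
move=> fK gK relB a b a0.
have fi := can_inj fK.
have fa0 : f a != 0 by rewrite -(rmorph0 f) (inj_eq fi).
have [a' [b' [a'0 e gen]]] := relB _ (f b) fa0.
exists (g a'), (g b'); split.
- by rewrite -(inj_eq fi) gK rmorph0.
- by apply: fi; rewrite !rmorphM !gK.
move=> u v /(congr1 f); rewrite !rmorphM => /gen[h [hu hv]].
by exists (g h); split; apply: fi; rewrite rmorphM !gK.
Qed.

Section MultivariateIso.

Variables (K : fieldType) (n : nat).

(** Evaluation at the last variable, the inverse of the reading of a polynomial
    in n + 1 variables as a polynomial in the last one. *)
Definition ununi (p : {poly {mpoly K[n]}}) : {mpoly K[n.+1]} :=
  (mpwiden p).['X_ord_max].

Lemma muniXm (m : 'X_{1..n.+1}) : muni 'X_[K, m] =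
  'X_[[multinom m (widen_ord (leqnSn n) i) | i < n]] *: 'X^(m ord_max).
Proof. by rewrite muniE msuppX big_seq1 mcoeffX eqxx scale1r. Qed.

Lemma ununi_muni : cancel (@muni n K) ununi.
Proof.
have ununiD p q : ununi (p + q) = ununi p + ununi q.
  by rewrite /ununi raddfD hornerD.
elim/mpolyind => [|c m p _ _ IH].
  by rewrite muni0 /ununi raddf0 horner0.
rewrite muniD ununiD; congr (_ + _); last exact: IH.
rewrite muniZ muniXm.
rewrite scalerA /ununi mpwidenZ /mpwiden rmorphXn /= map_polyX.
rewrite hornerZ hornerXn mwidenM mwidenC mwidenX mul_mpolyC -scalerAl.
congr (_ *: _); rewrite mpolyXn -mpolyXD; congr 'X_[_]; apply/mnmP => i.
rewrite mnmDE mulmnE mnm1E.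
have [->|ni] := eqVneq i ord_max.
  by rewrite mnmwiden_ordmax mul1n.
have lt : (i < n)%N.
  have := ltn_ord i; rewrite ltnS leq_eqVlt => /orP[/eqP e|//].
  by case/eqP: ni; apply/val_inj.
have -> : i = widen_ord (leqnSn n) (Ordinal lt) by apply/val_inj.
rewrite mnmwiden_widen mnmE mul0n addn0.
by [].
Qed.

Lemma muni_ununi : cancel ununi (@muni n K).
Proof.
move=> p; elim/poly_ind: p => [|p c IH].
  by rewrite /ununi raddf0 horner0 muni0.
have widenE : muni (mwiden c) = c%:P.
  elim/mpolyind: c => [|c m q _ _ e]; first by rewrite mwiden0 muni0.
  rewrite mwidenD muniD e mwidenZ muniZ mwidenX muniXm mnmwiden_ordmax expr0.
  rewrite alg_polyC polyCD -mul_polyC -polyCM mul_mpolyC.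
  congr ((_ *: 'X_[_])%:P + _).
  by apply/mnmP => i; rewrite mnmE mnmwiden_widen.
rewrite /ununi raddfD /= hornerD muniD mpwidenC hornerC widenE; congr (_ + _).
rewrite rmorphM /= mpwidenX hornerMX muniM -/(ununi p) IH; congr (_ * _).
rewrite muniXm mnm1E eqxx expr1 (_ : [multinom _ | _ < _] = 0%MM) ?mpolyX0 ?scale1r //.
apply/mnmP => i; rewrite mnmE mnm1E mnm0E; apply/eqP; rewrite eqb0.
by apply/eqP => /(congr1 val) /= e; have := ltn_ord i; rewrite -e ltnn.
Qed.

End MultivariateIso.

Lemma cyclic_relations_mpoly (K : fieldType) n : cyclic_relations {mpoly K[n]}.
Proof.
elim: n => [|n IH].
  apply: (@cyclic_relations_iso _ K (@mcoeff 0 K 0%MM) (@mpolyC 0 K)).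
  - by move=> p; rewrite /= -nvar0_mpolyC.
  - exact: mpolyCK.
  exact: cyclic_relations_field.
apply: (@cyclic_relations_iso _ {poly {mpoly K[n]}} (@muni n K)).
- exact: ununi_muni.
- exact: muni_ununi.
exact: cyclic_relations_poly.
Qed.

Section PrimeElements.

Variable R : idomainType.
Hypothesis relR : cyclic_relations R.

(** Let p = g p' and a = g a', where (p', a') generates the relations of p and a.
    By irreducibility p' is a unit, and p divides a, or g is, and p divides b. *)
Lemma irreducible_prime (p : R) : p != 0 -> p \isn't a GRing.unit ->
  (forall a b, p = a * b -> a \is a GRing.unit \/ b \is a GRing.unit) ->
  prime_element p.
Proof.
move=> p0 pu irr; split=> // a b [c abE].
have [p' [a' [p'0 e gen]]] := relR a p0.
have [g [pg ag]] := gen p a (mulrC _ _).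
have [|h [bE cE]] := gen b c; first by rewrite abE mulrC.
have [gu|p'u] := irr _ _ pg; [right|left].
  by exists (h / g); rewrite bE pg mulrA divrK.
by exists (a' / p'); rewrite ag pg mulrCA divrK.
Qed.

End PrimeElements.

(** * Divisibility *)

Section Divisibility.

Variable R : idomainType.
Implicit Types p a b c : R.

Lemma divides_refl p : divides p p.
Proof. by exists 1; rewrite mul1r. Qed.

Lemma divides0 p : divides p 0.
Proof. by exists 0; rewrite mul0r. Qed.

Lemma divides_mull p a b : divides p b -> divides p (a * b).
Proof. by case=> c ->; exists (a * c); rewrite mulrA. Qed.

Lemma divides_mulr p a b : divides p a -> divides p (a * b).
Proof. by rewrite mulrC; exact: divides_mull. Qed.

Lemma dividesD p a b : divides p a -> divides p b -> divides p (a + b).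
Proof. by case=> c -> [d ->]; exists (c + d); rewrite mulrDl. Qed.

Lemma dividesN p a : divides p a -> divides p (- a).
Proof. by case=> c ->; exists (- c); rewrite mulNr. Qed.

Lemma dividesB p a b : divides p a -> divides p b -> divides p (a - b).
Proof. by move=> pa pb; apply/dividesD/dividesN. Qed.

Lemma divides_sum (I : eqType) p (s : seq I) (P : pred I) (F : I -> R) :
  {in s, forall x, P x -> divides p (F x)} -> divides p (\sum_(x <- s | P x) F x).
Proof.
move=> pF; rewrite big_seq_cond; apply: big_ind => [|a b|x /andP[xs Px]].
- exact: divides0.
- exact: dividesD.
exact: pF.
Qed.

Lemma divides_trans a b c : divides a b -> divides b c -> divides a c.
Proof. by case=> x -> [y ->]; exists (y * x); rewrite mulrA. Qed.

Lemma divides_unit p a : a \is a GRing.unit -> divides p a -> p \is a GRing.unit.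
Proof. by move=> au [r aE]; move: au; rewrite aE unitrM => /andP[]. Qed.

Lemma prime_divides_prod (I : eqType) p (s : seq I) (P : pred I) (F : I -> R) :
  prime_element p -> divides p (\prod_(x <- s | P x) F x) ->
  exists x, [/\ x \in s, P x & divides p (F x)].
Proof.
case=> _ pu pP; elim: s => [|x s IH].
  by rewrite big_nil => /(divides_unit (unitr1 _)); rewrite (negPf pu).
have IH' : divides p (\prod_(y <- s | P y) F y) ->
    exists y, [/\ y \in x :: s, P y & divides p (F y)].
  by move=> /IH[y [ys Py pFy]]; exists y; rewrite in_cons ys orbT.
rewrite big_cons; case: ifP => // Px /pP[pFx|//].
by exists x; rewrite in_cons eqxx.
Qed.

Lemma prod_primes_divides (I : eqType) (s : seq I) (F : I -> R) a :
  uniq s -> {in s, forall x, prime_element (F x)} ->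
  {in s &, forall x y, x != y -> ~ divides (F x) (F y)} ->
  {in s, forall x, divides (F x) a} -> divides (\prod_(x <- s) F x) a.
Proof.
elim: s => [|x s IH] /=; first by rewrite big_nil; exists a; rewrite mulr1.
move=> /andP[xs us] pF ndv dv.
have [||||r aE] := IH.
- exact: us.
- by move=> y ys; apply: pF; rewrite in_cons ys orbT.
- by move=> y z ys zs; apply: ndv; rewrite in_cons ?ys ?zs orbT.
- by move=> y ys; apply: dv; rewrite in_cons ys orbT.
have xin : x \in x :: s by rewrite in_cons eqxx.
have [_ _ /(_ r (\prod_(y <- s) F y))] := pF x xin.
case=> [|[c rE]|].
- by rewrite -aE; exact: dv.
- by exists c; rewrite big_cons aE rE mulrA.
case/(prime_divides_prod (pF x xin)) => y [ys _].
have yin : y \in x :: s by rewrite in_cons ys orbT.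
by move/(ndv x y xin yin); case; apply: contraNneq xs => ->.
Qed.

End Divisibility.

(** * Primality of lines and smooth conics *)

Section LinesAndConics.

Variable K : closedFieldType.
Local Notation S := {mpoly K[3]}.

Lemma homog_msizeS n k (p : {mpoly K[n]}) :
  p \is k.-homog -> p != 0 -> msize p = k.+1.
Proof.
by move=> hp p0; rewrite -mlead_deg // (dhomog_mf hp) // mlead_supp.
Qed.

Lemma msize1_unit n (p : {mpoly K[n]}) :
  p != 0 -> (msize p <= 1)%N -> p \is a GRing.unit.
Proof.
move=> p0 /msize1_polyC pE; rewrite pE rmorph_unit // unitfE.
by apply: contraNneq p0 => e; rewrite pE e.
Qed.

Lemma unit_msize1 n (p : {mpoly K[n]}) : p \is a GRing.unit -> msize p = 1%N.
Proof.
move=> pu.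
have p0 : p != 0 by apply: contraTneq pu => ->; rewrite unitr0.
have v0 : p^-1 != 0 by rewrite invr_eq0.
have := msizeM p0 v0; rewrite mulrV // msize1.
move: p0 v0; rewrite -!msize_poly_eq0.
by move: (mmeasure mdeg p) (mmeasure mdeg p^-1) => x y; lia.
Qed.

Lemma homog_nonunit n k (p : {mpoly K[n]}) :
  p \is k.+1.-homog -> p != 0 -> p \isn't a GRing.unit.
Proof.
by move=> hp p0; apply/negP => /unit_msize1; rewrite (homog_msizeS hp p0).
Qed.

Lemma line_irreducible n (l a b : {mpoly K[n]}) : l \is 1.-homog -> l != 0 ->
  l = a * b -> a \is a GRing.unit \/ b \is a GRing.unit.
Proof.
move=> hl l0 lE; have := homog_msizeS hl l0.
have [a0 b0] : a != 0 /\ b != 0.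
  by apply/andP; rewrite -negb_or -mulf_eq0 -lE.
rewrite lE msizeM // => sz.
have [a1|a1] := leqP (msize a) 1; first by left; apply: msize1_unit.
right; apply: msize1_unit => //; move: sz a1.
by move: (mmeasure mdeg a) (mmeasure mdeg b) => x y; lia.
Qed.

Lemma line_prime n (l : {mpoly K[n]}) : l \is 1.-homog -> l != 0 -> prime_element l.
Proof.
move=> hl l0; apply: irreducible_prime => //.
- exact: cyclic_relations_mpoly.
- exact: homog_nonunit hl l0.
by move=> a b; apply: line_irreducible.
Qed.

Lemma linear_formE n (l : {mpoly K[n]}) : l \is 1.-homog ->
  l = \sum_i l@_U_(i) *: 'X_i.
Proof.
move=> hl; apply/mpolyP => m; rewrite raddf_sum /=.
have [/mdeg1P[i0 /eqP ->]|m1] := boolP (mdeg m == 1%N).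
  rewrite (bigD1 i0) //= mcoeffZ mcoeffXU eqxx mulr1 big1 ?addr0 // => i ii0.
  by rewrite mcoeffZ mcoeffXU (negPf ii0) mulr0.
rewrite (dhomog_nemf_coeff hl m1) big1 // => i _.
rewrite mcoeffZ mcoeffX; case: eqP => [e|]; last by rewrite mulr0.
by rewrite -e mdeg1 in m1.
Qed.

(** A 3 x 2 matrix has a nonzero left kernel. *)
Lemma linear_forms_common_zero (a b : S) : a \is 1.-homog -> b \is 1.-homog ->
  exists v : 'I_3 -> K, [/\ exists i, v i != 0, a.@[v] = 0 & b.@[v] = 0].
Proof.
move=> ha hb.
pose M : 'M[K]_(3, 2) := \matrix_(i, j) (if j == ord0 then a@_U_(i) else b@_U_(i)).
have : kermx M != 0.
  rewrite -mxrank_eq0 mxrank_ker -lt0n subn_gt0.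
  exact: leq_ltn_trans (rank_leq_col M) _.
case/rowV0Pn => u /sub_kermxP uM u0; exists (u 0).
have ev l : l \is 1.-homog -> l.@[u 0] = \sum_i u 0 i * l@_U_(i).
  move=> hl; rewrite {1}(linear_formE hl) raddf_sum; apply: eq_bigr => i _.
  by rewrite /= mevalZ mevalXU mulrC.
split.
- have /existsP[k uk] : [exists i, u 0 i != 0].
    apply: contraNT u0 => /existsPn uz; apply/eqP/rowP => i.
    by rewrite mxE; apply/eqP/negPn/uz.
  by exists k.
- have := congr1 (fun A : 'rV_2 => A 0 ord0) uM; rewrite !mxE ev // => {2}<-.
  by apply: eq_bigr => i _; rewrite mxE.
have := congr1 (fun A : 'rV_2 => A 0 ord_max) uM; rewrite !mxE ev // => {2}<-.
by apply: eq_bigr => i _; rewrite mxE.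
Qed.

Lemma smooth_conic_neq0 (q : S) : is_smooth_conic q -> q != 0.
Proof.
case=> _ smooth; apply/eqP => q0.
have [||i] := smooth (fun=> 1); first by exists ord0; rewrite oner_eq0.
  by rewrite q0 meval0.
by rewrite q0 mderiv0 meval0 eqxx.
Qed.

(** The vanishing of the product in degrees 0 and 1 forces both constant terms
    to vanish. *)
Lemma homog2_factors (a b : S) : a * b \is 2.-homog ->
  msize a = 2 -> msize b = 2 -> a \is 1.-homog /\ b \is 1.-homog.
Proof.
move=> hab.
wlog a00 : a b hab / a@_0%MM = 0.
  move=> wl sa sb.
  have : a@_0%MM * b@_0%MM = 0.
    rewrite -rmorphM /=. by apply: (dhomog_nemf_coeff hab); rewrite mf0.
  move/eqP; rewrite mulf_eq0 => /orP[] /eqP z; first exact: wl.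
  by have [] // := wl b a; rewrite // mulrC.
have homog1 (p : S) : msize p = 2 -> p@_0%MM = 0 -> p \is 1.-homog.
  move=> sp p0; apply/dhomogP => m mp.
  have := msize_mdeg_lt mp; rewrite sp.
  case E : (mdeg m) => [|[|?]] // _.
  move/eqP: E; rewrite mdeg_eq0 => /eqP E.
  by move: mp; rewrite E mcoeff_msupp p0 eqxx.
move=> sa sb; have ha := homog1 a sa a00; split=> //; apply: homog1 => //.
have a0 : a != 0 by rewrite -msize_poly_eq0 sa.
pose b1 := b - (b@_0%MM)%:MP.
have : pihomog mdeg 1 (a * b) = b@_0%MM *: a + pihomog mdeg 1 (a * b1).
  rewrite -[in LHS](subrK ((b@_0%MM)%:MP) b) -/b1 mulrDr raddfD /= addrC.
  by rewrite mulrC mul_mpolyC linearZ /= pihomog_dE.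
rewrite (pihomog_ne0 _ hab) //.
have [b10|b10] := eqVneq b1 0.
  rewrite b10 mulr0 raddf0 addr0 => /esym/eqP.
  by rewrite scaler_eq0 (negPf a0) orbF => /eqP.
have hb1 : b1 \is 1.-homog.
  apply/dhomogP => m mp.
  have mlt : (mdeg m < 2)%N.
    rewrite ltnNge; apply/negP => m2; move: mp; rewrite mcoeff_msupp mcoeffB mcoeffC.
    have -> : (m == 0%MM) = false by rewrite -mdeg_eq0; case: (mdeg m) m2.
    by rewrite memN_msupp_eq0 ?mulr0 ?subrr ?eqxx // msize_mdeg_ge // sb.
  case E : (mdeg m) mlt => [|[|?]] // _.
  move/eqP: E; rewrite mdeg_eq0 => /eqP E.
  by move: mp; rewrite E mcoeff_msupp mcoeffB mcoeffC eqxx mulr1 subrr eqxx.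
rewrite (pihomog_ne0 _ (dhomogM ha hb1)) // addr0 => /esym/eqP.
by rewrite scaler_eq0 (negPf a0) orbF => /eqP.
Qed.

(** A conic that is a product of two lines is singular where they meet. *)
Lemma smooth_conic_prime (q : S) : is_smooth_conic q -> prime_element q.
Proof.
move=> qs; have q0 := smooth_conic_neq0 qs; have [hq smooth] := qs.
apply: irreducible_prime => //.
- exact: cyclic_relations_mpoly.
- exact: homog_nonunit hq q0.
move=> a b qE; have := homog_msizeS hq q0.
have [a0 b0] : a != 0 /\ b != 0.
  by apply/andP; rewrite -negb_or -mulf_eq0 -qE.
rewrite qE msizeM // => sz.
have [a1|a1] := leqP (msize a) 1; first by left; apply: msize1_unit.
have [b1|b1] := leqP (msize b) 1; first by right; apply: msize1_unit.
have [|||ha hb] := @homog2_factors a b; rewrite -?qE //;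
  try by move: sz a1 b1; move: (mmeasure mdeg a) (mmeasure mdeg b) => x y; lia.
have [v [v0 av bv]] := linear_forms_common_zero ha hb.
have [|i] := smooth v v0; first by rewrite qE mevalM av mul0r.
by rewrite qE mderivM mevalD !mevalM av bv mulr0 mul0r addr0 eqxx.
Qed.

Lemma component_prime (p : S) : is_line p \/ is_smooth_conic p -> prime_element p.
Proof. by case=> [[hp p0]|/smooth_conic_prime //]; apply: line_prime. Qed.

(** Such primes are associated, and the units are the nonzero constants. *)
Lemma prime_divides_same_locus (p r : S) :
  prime_element p -> prime_element r -> divides p r -> same_locus p r.
Proof.
move=> [_ pu _] [r0 _ rP] [c rE].
have [_ c0] : p != 0 /\ c != 0.
  by apply/andP; rewrite andbC -negb_or -mulf_eq0 -rE.
have cu : c \is a GRing.unit.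
  have [|[d cE]|[d pE]] := rP c p; first by rewrite -rE; exact: divides_refl.
    have : d * p = 1.
      by apply: (mulfI c0); rewrite mulr1 {2}cE rE; ring.
    move=> dp; case/negP: pu; apply/unitrP; exists d; by rewrite dp mulrC dp.
  apply/unitrP; exists d.
  have p0 : p != 0 by apply: contraNneq r0 => z; rewrite rE z mulr0.
  have e : d * c = 1 by apply: (mulIf p0); rewrite mul1r -mulrA -rE -pE.
  by rewrite e mulrC e.
have /eqP/msize_poly1P[k k0 cE] := unit_msize1 cu.
move=> v; rewrite rE mevalM cE mevalC; split=> [->|/eqP]; first by rewrite mulr0.
by rewrite mulf_eq0 (negPf k0) => /eqP.
Qed.

End LinesAndConics.

(** * Homogeneous polynomials and parallel vectors *)

Section HomogeneousPolynomials.

Variables (K : fieldType) (n : nat).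
Implicit Types p q c : {mpoly K[n]}.

Lemma divides_msize p q : divides p q -> q != 0 -> (msize p <= msize q)%N.
Proof.
case=> r ->; rewrite mulf_eq0 negb_or => /andP[r0 p0]; rewrite msizeM //.
move: r0 p0; rewrite -!msize_poly_eq0.
by move: (mmeasure mdeg p) (mmeasure mdeg r) => x y; lia.
Qed.

Lemma mderiv_homog k p i : p \is k.+1.-homog -> mderiv i p \is k.-homog.
Proof.
move=> hp; apply/dhomogP => m; rewrite mcoeff_msupp mcoeff_deriv => nz.
apply/eqP; apply: contraNT nz => mk; rewrite (dhomog_nemf_coeff hp) ?mul0rn //.
have e : mdeg (m + U_(i))%MM = (mdeg m).+1 by rewrite mdegD mdeg1 addn1.
by rewrite /= e eqSS.
Qed.

Lemma euler k p : p \is k.-homog ->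
  \sum_(i < n) 'X_i * mderiv i p = k%:R *: p.
Proof.
move=> hp.
transitivity (\sum_(m <- msupp p) p@_m *: ((mdeg m)%:R *: 'X_[K, m])).
  rewrite {1}(mpolyE p); under eq_bigr => i _ do rewrite raddf_sum mulr_sumr.
  rewrite exchange_big; apply: eq_bigr => m _ /=.
  rewrite mdegE natr_sum scaler_suml scaler_sumr; apply: eq_bigr => i _.
  rewrite mderivZ mderivX -!scalerAr; congr (_ *: _).
  have [->|mi] := eqVneq (m i) 0%N; first by rewrite !scale0r.
  congr (_ *: _); rewrite -mpolyXD addmC submK //.
  by apply/mnm_lepP => j; rewrite mnm1E; case: eqP => // <-; rewrite lt0n.
rewrite [in RHS](mpolyE p) scaler_sumr !big_seq; apply: eq_bigr => m mp.
by rewrite (dhomog_mf hp mp) scalerA mulrC -scalerA.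
Qed.

(** Monomials of positive degree multiply p into degrees greater than k. *)
Lemma mcoeffM_homog k p c (m : 'X_{1..n}) : p \is k.-homog -> (mdeg m <= k)%N ->
  (c * p)@_m = c@_0%MM * p@_m.
Proof.
move=> hp mk; pose c1 := c - (c@_0%MM)%:MP.
have cE : c = (c@_0%MM)%:MP + c1 by rewrite addrC subrK.
rewrite {1}cE mulrDl mcoeffD mcoeffCM.
suff -> : (c1 * p)@_m = 0 by rewrite addr0.
rewrite [c1]mpolyE mulr_suml raddf_sum /= big_seq big1 // => m1 m1c.
rewrite -scalerAl mcoeffZ (dhomog_nemf_coeff (dhomogM (_ : 'X_[m1] \is (mdeg m1).-homog) hp)).
- by rewrite mulr0.
- by rewrite dhomogX.
have m10 : mdeg m1 != 0%N.
  apply: contraTneq m1c => /eqP; rewrite mdeg_eq0 => /eqP ->.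
  by rewrite mcoeff_msupp mcoeffB mcoeffC eqxx mulr1 subrr eqxx.
by move: m10 mk => /=; move: (mdeg m1) (mdeg m) => x y; lia.
Qed.

End HomogeneousPolynomials.

Section Syzygies.

Variable K : closedFieldType.
Local Notation S := {mpoly K[3]}.
Implicit Types (f p : S) (g h : 'rV[S]_3).

Definition o0 : 'I_3 := @Ordinal 3 0 isT.
Definition o1 : 'I_3 := @Ordinal 3 1 isT.
Definition o2 : 'I_3 := @Ordinal 3 2 isT.

Lemma ord3P (P : 'I_3 -> Prop) : P o0 -> P o1 -> P o2 -> forall i, P i.
Proof.
move=> P0 P1 P2 [[|[|[|m]]] lt] //.
- by rewrite (_ : Ordinal lt = o0) //; apply/val_inj.
- by rewrite (_ : Ordinal lt = o1) //; apply/val_inj.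
- by rewrite (_ : Ordinal lt = o2) //; apply/val_inj.
Qed.

Lemma sum_ord3 (V : zmodType) (F : 'I_3 -> V) :
  \sum_(i < 3) F i = F o0 + F o1 + F o2.
Proof.
rewrite !big_ord_recl big_ord0 addr0 addrA.
by congr (F _ + F _ + F _); apply/val_inj.
Qed.

Definition vec (a b c : S) : 'rV[S]_3 := \row_i [:: a; b; c]`_i.

Lemma vec0E a b c : vec a b c 0 o0 = a. Proof. by rewrite mxE. Qed.
Lemma vec1E a b c : vec a b c 0 o1 = b. Proof. by rewrite mxE. Qed.
Lemma vec2E a b c : vec a b c 0 o2 = c. Proof. by rewrite mxE. Qed.
Definition vecE := (vec0E, vec1E, vec2E).

Lemma row3P g h : g 0 o0 = h 0 o0 -> g 0 o1 = h 0 o1 -> g 0 o2 = h 0 o2 -> g = h.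
Proof. by move=> e0 e1 e2; apply/rowP; apply: ord3P. Qed.

Definition cross g h : 'rV[S]_3 :=
  vec (g 0 o1 * h 0 o2 - g 0 o2 * h 0 o1)
      (g 0 o2 * h 0 o0 - g 0 o0 * h 0 o2)
      (g 0 o0 * h 0 o1 - g 0 o1 * h 0 o0).

Lemma cross_eq0_parallel g h : cross g h = 0 ->
  forall i j, g 0 i * h 0 j = g 0 j * h 0 i.
Proof.
move=> /rowP c0.
have := c0 o0; have := c0 o1; have := c0 o2; rewrite !vecE !mxE.
move=> /eqP; rewrite subr_eq0 => /eqP e01 /eqP; rewrite subr_eq0 => /eqP e20.
move=> /eqP; rewrite subr_eq0 => /eqP e12.
by apply: ord3P; apply: ord3P.
Qed.

(** The cross product and the gradient of f are orthogonal to both g and h. In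
    the proof, T is the expansion of the double cross product. *)
Lemma cross_syzygies_gradient f g h : jacobian_syzygy f g -> jacobian_syzygy f h ->
  forall i j, cross g h 0 i * mderiv j f = cross g h 0 j * mderiv i f.
Proof.
rewrite /jacobian_syzygy !sum_ord3 => A B.
pose T k := h 0 k * (g 0 o0 * mderiv o0 f + g 0 o1 * mderiv o1 f + g 0 o2 * mderiv o2 f)
  - g 0 k * (h 0 o0 * mderiv o0 f + h 0 o1 * mderiv o1 f + h 0 o2 * mderiv o2 f).
have T0 k : T k = 0 by rewrite /T A B !mulr0 subrr.
have e01 : cross g h 0 o0 * mderiv o1 f = cross g h 0 o1 * mderiv o0 f + T o2.
  by rewrite !vecE /T; ring.
have e12 : cross g h 0 o1 * mderiv o2 f = cross g h 0 o2 * mderiv o1 f + T o0.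
  by rewrite !vecE /T; ring.
have e20 : cross g h 0 o2 * mderiv o0 f = cross g h 0 o0 * mderiv o2 f + T o1.
  by rewrite !vecE /T; ring.
rewrite !T0 !addr0 in e01 e12 e20.
by apply: ord3P; apply: ord3P.
Qed.

(** The generator of the relations between one nonzero coordinate of g and its
    counterpart in h serves for all coordinates. *)
Lemma parallel_vectors g h : g != 0 ->
  (forall i j, g 0 i * h 0 j = g 0 j * h 0 i) ->
  exists a b w, [/\ a != 0, g = a *: w & h = b *: w].
Proof.
move=> g0 par.
have /existsP[j gj] : [exists j, g 0 j != 0].
  apply: contraNT g0 => /existsPn gz; apply/eqP/rowP => j.
  by rewrite mxE; apply/eqP/negPn/gz.
have [a [b [a0 _ gen]]] := @cyclic_relations_mpoly K 3 _ (h 0 j) gj.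
have w_ex i : {w | g 0 i = w * a /\ h 0 i = w * b}.
  by apply/cid/gen; rewrite par mulrC.
exists a, b, (\row_i sval (w_ex i)); split=> //; apply/rowP => i; rewrite !mxE;
  by case: (w_ex i) => /= w [wa wb]; rewrite mulrC.
Qed.

End Syzygies.

(** * The bounds on the type *)

Section LowerBound.

Variable K : closedFieldType.
Hypothesis char0 : forall n, n.+1%:R != 0 :> K.
Local Notation S := {mpoly K[3]}.
Implicit Types (f p : S) (g h : 'rV[S]_3).

(** Some derivative is nonzero by the relation of Euler, and its degree is too
    small for p to divide it. *)
Lemma exists_mderiv_not_divisible k p : p \is k.+1.-homog -> p != 0 ->
  exists i, ~ divides p (mderiv i p).
Proof.
move=> hp p0.
have /existsP[i di] : [exists i, mderiv i p != 0].
  have : k.+1%:R *: p != 0 by rewrite -mul_mpolyC mulf_neq0 // mpolyC_eq0 char0.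
  apply: contraNT => /existsPn dz; rewrite -(euler hp) big1 // => i _.
  by have /negPn/eqP -> := dz i; rewrite mulr0.
exists i => /divides_msize /(_ di).
by rewrite (homog_msizeS hp p0) (homog_msizeS (mderiv_homog i hp) di) ltnn.
Qed.

Lemma component_homog p : is_line p \/ is_smooth_conic p ->
  exists k, p \is k.+1.-homog.
Proof. by case=> [[hp _]|[hp _]]; [exists 0%N | exists 1%N]. Qed.

Section Arrangement.

Variable A : conic_line_arrangement K.
Local Notation f := (equation A).

Lemma component_ndivides i j : i != j ->
  ~ divides (@component K A i) (@component K A j).
Proof.
move=> ij d; apply: (component_distinct ij).
by apply: prime_divides_same_locus d; apply/component_prime/componentP.
Qed.

Lemma equation_neq0 : f != 0.
Proof.
apply/prodf_neq0 => i _.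
by have [] := component_prime (componentP i).
Qed.

Lemma equation_homog : f \is (curve_degree f).-homog.
Proof.
apply/(@dhomog_msize _ _ mdeg (\sum_(i < ncomponents A) (msize (component i)).-1)).
rewrite /equation; elim/big_ind2: _ => [|d1 p1 d2 p2 h1 h2|i _].
- exact: dhomog1.
- exact: dhomogM.
by have [k hk] := component_homog (componentP i); apply: dhomog_msize hk.
Qed.

(** With w the cross product, multiply w_k f_j = w_j f_k by x_k, sum over k and
    use the relation of Euler. *)
Lemma determinant_gradient G H j :
  jacobian_syzygy f G -> jacobian_syzygy f H ->
  (curve_degree f)%:R%:MP * f * cross G H 0 j =
  (\sum_k 'X_k * cross G H 0 k) * mderiv j f.
Proof.
move=> GP HP; rewrite mul_mpolyC -(euler equation_homog) !mulr_suml.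
apply: eq_bigr => k _.
by rewrite -!mulrA [mderiv k f * _]mulrC (cross_syzygies_gradient GP HP k j).
Qed.

(** Write f = p h with p the component. Modulo p, the preceding identity becomes
    0 = a p_j h for the determinant a, and p divides neither h nor all the p_j. *)
Lemma component_divides_determinant (i : 'I_(ncomponents A)) G H :
  jacobian_syzygy f G -> jacobian_syzygy f H ->
  divides (component i) (\sum_j 'X_j * cross G H 0 j).
Proof.
move=> GP HP; set a := \sum_j _.
have [k hp] := component_homog (componentP i).
have pp := component_prime (componentP i); have [p0 _ pP] := pp.
have [j ndj] := exists_mderiv_not_divisible hp p0.
pose h := \prod_(l < ncomponents A | l != i) component l.
have fE : f = component i * h by rewrite /equation (bigD1 i).
have ndh : ~ divides (component i) h.
  by case/(prime_divides_prod pp) => l [_ li]; apply: component_ndivides; rewrite eq_sym.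
have : divides (component i) (a * mderiv j (component i) * h).
  have -> : a * mderiv j (component i) * h =
      (curve_degree f)%:R%:MP * f * cross G H 0 j - a * component i * mderiv j h.
    by rewrite determinant_gradient // -/a fE mderivM; ring.
  apply: dividesB; last exact/divides_mulr/divides_mull/divides_refl.
  by apply/divides_mulr/divides_mull; rewrite fE; exact/divides_mulr/divides_refl.
by case/pP => // /pP[].
Qed.

(** If the determinant vanished, so would the cross product by
    [determinant_gradient]; otherwise it is a nonzero multiple of f. *)
Lemma determinant_degree G H d1 d2 :
  jacobian_syzygy f G -> jacobian_syzygy f H ->
  homogeneous_of_degree d1 G -> homogeneous_of_degree d2 H ->
  cross G H != 0 -> (0 < curve_degree f)%N -> (curve_degree f <= (d1 + d2).+1)%N.
Proof.
move=> GP HP hG hH w0 fpos; set a := \sum_j 'X_j * cross G H 0 j.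
have ha : a \is (d1 + d2).+1.-homog.
  apply: rpred_sum => j _; rewrite -[(d1 + d2).+1]add1n; apply: dhomogM.
    by rewrite dhomogX /= mdeg1.
  by move: j; apply: ord3P; rewrite vecE; apply: rpredB;
    exact: dhomogM (hG _) (hH _).
have a0 : a != 0.
  apply: contraNneq w0 => az; apply/eqP/rowP => j; rewrite [RHS]mxE.
  have := determinant_gradient j GP HP; rewrite -/a az mul0r => /eqP.
  rewrite !mulf_eq0 mpolyC_eq0 (negPf equation_neq0) orbF.
  by rewrite -(prednK fpos) (negPf (char0 _)) => /eqP.
have : divides f a.
  apply: prod_primes_divides; first exact: index_enum_uniq.
  - by move=> i _; apply/component_prime/componentP.
  - by move=> i j _ _; apply: component_ndivides.
  by move=> i _; apply: component_divides_determinant.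
move/divides_msize => /(_ a0); rewrite (homog_msizeS ha a0).
by rewrite (homog_msizeS equation_homog equation_neq0) ltnS.
Qed.

(** Parallel generators are multiples of a common vector w, again a syzygy because
    the scalars form a domain. A combination of generators of degrees at least
    that of G i cannot have smaller degree, so w is G i up to a constant and G j
    is redundant. *)
Lemma minimal_generators_not_parallel ds (G : 'I_(size ds) -> 'rV[S]_3)
    (i j : 'I_(size ds)) :
  i != j ->
  (forall k, jacobian_syzygy f (G k)) ->
  (forall k : 'I_(size ds), homogeneous_of_degree (nth 0%N ds k) (G k)) ->
  generates (jacobian_syzygy f) G [set: 'I_(size ds)] ->
  (forall J : {set 'I_(size ds)},
     generates (jacobian_syzygy f) G J -> J = [set: 'I_(size ds)]) ->
  (forall k : 'I_(size ds), nth 0%N ds i <= nth 0%N ds k)%N ->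
  cross (G i) (G j) != 0.
Proof.
move=> ij Gsyz Ghom Ggen Gmin imin; apply/eqP => /cross_eq0_parallel par.
have redundant k l c : k != l -> G l = c *: G k -> False.
  move=> kl lE; have : [set~ l] = [set: 'I_(size ds)].
    apply: Gmin => g /Ggen[x ->].
    exists (fun m => if m == k then x k + x l * c else x m).
    rewrite (bigD1 l) ?inE //= (bigD1 k) ?inE //= [RHS](bigD1 k) ?inE //=.
    rewrite eqxx addrA; congr (_ + _).
      by rewrite lE scalerDl scalerA addrC.
    apply: eq_big => [m|m /andP[]].
      by rewrite !inE.
    by move=> _ /negPf ->.
  by move/setP/(_ l); rewrite !inE eqxx.
have Gi0 : G i != 0.
  apply/eqP => z; apply: (redundant j i 0); first by rewrite eq_sym.
  by rewrite scale0r.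
have [a [b [w [a0 GiE GjE]]]] := parallel_vectors Gi0 par.
have w_syz : jacobian_syzygy f w.
  have := Gsyz i; rewrite /jacobian_syzygy GiE.
  under eq_bigr => k _ do rewrite mxE -mulrA.
  by rewrite -mulr_sumr => /eqP; rewrite mulf_eq0 (negPf a0) => /eqP.
have /existsP[k wk] : [exists k, w 0 k != 0].
  apply: contraNT Gi0 => /existsPn wz; apply/eqP/rowP => k; rewrite GiE !mxE.
  by have /negPn/eqP -> := wz k; rewrite mulr0.
have wdeg : (nth 0%N ds i < msize (w 0%R k))%N.
  rewrite -(mlead_deg wk) ltnS leqNgt; apply/negP => lt.
  have [c wE] := Ggen _ w_syz.
  have : (w 0 k)@_(mlead (w 0 k)) != 0 by rewrite -/(mleadc _) mleadc_eq0.
  move: (mlead (w 0 k)) lt => lm lt; rewrite wE summxE raddf_sum big1 ?eqxx // => m _ /=.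
  rewrite mxE.
  have ltm := leq_trans lt (imin m).
  rewrite (mcoeffM_homog _ (Ghom m k) (ltnW ltm)).
  by rewrite (dhomog_nemf_coeff (Ghom m k)) ?mulr0 //= ltn_eqF.
have au : a \is a GRing.unit.
  apply: msize1_unit => //.
  have Gik0 : G i 0 k != 0 by rewrite GiE mxE mulf_neq0.
  have := homog_msizeS (Ghom i k) Gik0; rewrite GiE mxE msizeM //.
  by move: wdeg; move: (mmeasure mdeg a) (mmeasure mdeg (w 0 k)) => x y; lia.
apply: (redundant i j (b / a) ij).
by rewrite GjE GiE scalerA divrK.
Qed.

Lemma type_bounds d1 d2 : two_smallest_degrees f d1 d2 ->
  (d2.+2 <= curve_degree f)%N ->
  (curve_degree f <= (d1 + d2).+1)%N /\ (d1 <= d2)%N.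
Proof.
case=> ds [sds [G [Gsyz Ghom Ggen Gmin]]] d2le.
have le12 : (d1 <= d2)%N by move: sds => /= /andP[].
split=> //.
pose i1 : 'I_(size [:: d1, d2 & ds]) := ord0.
pose i2 : 'I_(size [:: d1, d2 & ds]) := lift ord0 ord0.
apply: (determinant_degree (Gsyz i1) (Gsyz i2) (Ghom i1) (Ghom i2)); last first.
  exact: leq_trans d2le.
apply: minimal_generators_not_parallel => // k.
have := sorted_leq_nth leq_trans leqnn 0%N sds; apply=> //.
by rewrite inE.
Qed.

End Arrangement.
End LowerBound.

(** * Logarithmic vector fields *)

Section Derivations.

Variable K : closedFieldType.
Local Notation S := {mpoly K[3]}.
Implicit Types (f p r : S) (g h : 'rV[S]_3) (s : seq S).

(** Vectors of polynomials act as vector fields; the Jacobian syzygies of f are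
    the fields that kill f. *)
Definition der g p : S := \sum_(i < 3) g 0 i * mderiv i p.

Lemma derE g p : der g p =
  g 0 o0 * mderiv o0 p + g 0 o1 * mderiv o1 p + g 0 o2 * mderiv o2 p.
Proof. exact: sum_ord3. Qed.

Lemma derD g p r : der g (p + r) = der g p + der g r.
Proof. by rewrite !derE !mderivD; ring. Qed.

Lemma derM g p r : der g (p * r) = der g p * r + p * der g r.
Proof. by rewrite !derE !mderivM; ring. Qed.

Lemma derC g (c : K) : der g c%:MP = 0.
Proof. by rewrite derE !mderivC; ring. Qed.

Lemma derX g i : der g 'X_i = g 0 i.
Proof.
rewrite /der (bigD1 i) //= big1 ?addr0 => [|j ji].
  rewrite mderivX mnm1E eqxx scale1r (_ : (U_(i) - U_(i))%MM = 0%MM) ?mpolyX0 ?mulr1 //.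
  by apply/mnmP => k; rewrite mnmBE subnn mnm0E.
by rewrite mderivX mnm1E eq_sym (negPf ji) scale0r mulr0.
Qed.

Lemma derZl a g p : der (a *: g) p = a * der g p.
Proof. by rewrite !derE !mxE; ring. Qed.

Lemma derDl g h p : der (g + h) p = der g p + der h p.
Proof. by rewrite !derE !mxE; ring. Qed.

Lemma derBl g h p : der (g - h) p = der g p - der h p.
Proof. by rewrite !derE !mxE; ring. Qed.

Lemma der_homog k l g p : homogeneous_of_degree k g -> p \is l.+1.-homog ->
  der g p \is (k + l).-homog.
Proof.
move=> hg hp; apply: rpred_sum => i _; apply: dhomogM; first exact: hg.
exact: mderiv_homog.
Qed.

Definition euler_der : 'rV[S]_3 := vec 'X_o0 'X_o1 'X_o2.

Lemma der_euler k p : p \is k.-homog -> der euler_der p = k%:R%:MP * p.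
Proof. by move=> hp; rewrite mul_mpolyC -(euler hp) sum_ord3 derE !vecE. Qed.

(** If f has degree d, the Euler field multiplies f by d; so a field h with
    h f = e f is corrected into a field killing f. The scaling by d avoids a division. *)
Definition syzygy_of (d : nat) h e : 'rV[S]_3 := d%:R%:MP *: h - e *: euler_der.

Lemma syzygy_ofP d f h e : f \is d.-homog -> der h f = e * f ->
  jacobian_syzygy f (syzygy_of d h e).
Proof.
move=> hf hE; rewrite /jacobian_syzygy -/(der _ f) derBl !derZl hE (der_euler hf).
by ring.
Qed.

Lemma syzygy_of_homog d k h e : homogeneous_of_degree k.+1 h -> e \is k.-homog ->
  homogeneous_of_degree k.+1 (syzygy_of d h e).
Proof.
move=> hh he i; rewrite !mxE; apply: rpredB.
  by rewrite -[k.+1]add0n; apply: dhomogM; rewrite // -alg_mpolyC rpredZ // dhomog1.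
rewrite -[k.+1]addn1; apply: dhomogM => //.
by move: i; apply: ord3P; rewrite /= dhomogX /= mdeg1.
Qed.

Definition components_ok s : Prop :=
  [/\ uniq s, {in s, forall p, is_line p \/ is_smooth_conic p} &
      {in s &, forall p r, p != r -> ~ same_locus p r}].

Lemma arrangement_of_seq s : components_ok s ->
  exists A : conic_line_arrangement K,
    equation A = \prod_(p <- s) p /\
    forall p, p \in s -> exists i : 'I_(ncomponents A), component i = p.
Proof.
case=> us ok ns.
have compP (i : 'I_(size s)) : is_line s`_i \/ is_smooth_conic s`_i.
  by apply/ok/mem_nth.
have distinct (i j : 'I_(size s)) : i != j -> ~ same_locus s`_i s`_j.
  by move=> ij; apply: ns; rewrite ?mem_nth // nth_uniq.
exists (ConicLineArrangement compP distinct); split.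
  by rewrite /equation /= (big_nth 0) big_mkord.
move=> p ps; have lt : (index p s < size s)%N by rewrite index_mem.
by exists (Ordinal lt); rewrite /= nth_index.
Qed.

Section SquarefreeProduct.

Variable s : seq S.
Hypothesis s_ok : components_ok s.

Lemma ok_prime : {in s, forall p, prime_element p}.
Proof. by case: s_ok => _ ok _ p /ok/component_prime. Qed.

Lemma ok_ndivides : {in s &, forall p r, p != r -> ~ divides p r}.
Proof.
case: s_ok => _ _ ns p r ps rs pr d; apply: (ns p r ps rs pr).
by apply: prime_divides_same_locus d; apply: ok_prime.
Qed.

Lemma ok_split p : p \in s ->
  exists a, \prod_(r <- s) r = p * a /\ ~ divides p a.
Proof.
move=> ps; have [us _ _] := s_ok.
exists (\prod_(r <- s | r != p) r); split; first by rewrite (bigD1_seq p).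
case/(prime_divides_prod (ok_prime ps)) => r [rs rp].
by apply: ok_ndivides; rewrite // eq_sym.
Qed.

(** With f = p a, the product rule gives g(p) a = - p g(a), and p is prime to a. *)
Lemma syzygy_logarithmic g : jacobian_syzygy (\prod_(p <- s) p) g ->
  {in s, forall p, divides p (der g p)}.
Proof.
move=> gs p ps; have [a [sE nda]] := ok_split ps.
have [_ _ pP] := ok_prime ps.
have : divides p (der g p * a).
  exists (- der g a); apply/eqP; rewrite mulNr -addr_eq0 [_ * p]mulrC -derM -sE.
  by apply/eqP.
by case/pP.
Qed.

End SquarefreeProduct.
End Derivations.

(** * A conic, a pencil of lines and transversal lines *)

Section Configuration.

Variable K : closedFieldType.
Hypothesis char0 : forall n, n.+1%:R != 0 :> K.
Local Notation S := {mpoly K[3]}.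
Local Notation X := ('X_o0 : S).
Local Notation Y := ('X_o1 : S).
Local Notation Z := ('X_o2 : S).
Implicit Types (f p r : S) (g h : 'rV[S]_3) (s : seq S) (u v : K * K) (a b : K).

(** The lines of the second kind are the tangents of the conic x^2 = 4 y z, so
    that no three of them meet; those of the third kind pass through
    (1 : 0 : 0). *)
Definition conic : S := 2%:R%:MP * X ^+ 2 + Y * Z.
Definition line a : S := a%:MP * X + (a ^+ 2)%:MP * Y + Z.
Definition pencil u : S := u.1%:MP * Y + u.2%:MP * Z.

Definition pt a b c : 'I_3 -> K := fun i => [:: a; b; c]`_i.

Lemma eval_conic a b c : conic.@[pt a b c] = 2%:R * a ^+ 2 + b * c.
Proof. by rewrite /conic !expr2 mevalD !mevalM !mevalXU mevalC. Qed.

Lemma eval_line l a b c : (line l).@[pt a b c] = l * a + l ^+ 2 * b + c.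
Proof. by rewrite /line !mevalD !mevalM !mevalXU !mevalC. Qed.

Lemma eval_pencil u a b c : (pencil u).@[pt a b c] = u.1 * b + u.2 * c.
Proof. by rewrite /pencil !mevalD !mevalM !mevalXU !mevalC. Qed.

Lemma der_conic g : der g conic = 4%:R%:MP * X * g 0 o0 + Z * g 0 o1 + Y * g 0 o2.
Proof.
rewrite /conic expr2 derD !derM !derX derC (_ : 4%:R = 2%:R + 2%:R) ?mpolyCD;
  first by ring.
by rewrite -natrD.
Qed.

Lemma der_line g a : der g (line a) =
  a%:MP * g 0 o0 + (a ^+ 2)%:MP * g 0 o1 + g 0 o2.
Proof. by rewrite /line !derD !derM !derX !derC; ring. Qed.

Lemma der_pencil g u : der g (pencil u) = u.1%:MP * g 0 o1 + u.2%:MP * g 0 o2.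
Proof. by rewrite /pencil !derD !derM !derX !derC; ring. Qed.

Lemma X_homog i : ('X_i : S) \is 1.-homog.
Proof. by rewrite dhomogX /= mdeg1. Qed.

Lemma X_neq0 i : 'X_i != 0 :> S.
Proof. by rewrite -msize_poly_eq0 msizeX. Qed.

Lemma C_homog a : (a%:MP : S) \is 0.-homog.
Proof. by rewrite -alg_mpolyC rpredZ // dhomog1. Qed.

Lemma CX_homog a i : (a%:MP * 'X_i : S) \is 1.-homog.
Proof. exact: (dhomogM (C_homog a) (X_homog i)). Qed.

Lemma conic_homog : conic \is 2.-homog.
Proof.
apply: rpredD; last exact: (dhomogM (X_homog _) (X_homog _)).
rewrite expr2; exact: (dhomogM (C_homog _) (dhomogM (X_homog _) (X_homog _))).
Qed.

Lemma line_homog a : line a \is 1.-homog.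
Proof. by rewrite !rpredD ?CX_homog ?X_homog. Qed.

Lemma pencil_homog u : pencil u \is 1.-homog.
Proof. by rewrite rpredD ?CX_homog. Qed.

Lemma line_is_line a : is_line (line a).
Proof.
split; first exact: line_homog.
apply/eqP => /(congr1 (fun p : S => p.@[pt 0 0 1])).
by rewrite eval_line meval0 !mulr0 !add0r => /eqP; rewrite oner_eq0.
Qed.

Lemma pencil_is_line u : u != (0, 0) -> is_line (pencil u).
Proof.
move=> u0; split; first exact: pencil_homog.
apply: contraNneq u0 => e; apply/eqP; case: u e => u1 u2 e.
have := congr1 (fun p : S => p.@[pt 0 1 0]) e.
have := congr1 (fun p : S => p.@[pt 0 0 1]) e.
by rewrite !eval_pencil !meval0 /= !mulr0 !mulr1 add0r addr0 => -> ->.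
Qed.

Lemma conic_is_smooth : is_smooth_conic conic.
Proof.
split=> [|v [i vi] _]; first exact: conic_homog.
have d i' : mderiv i' conic = der (\row_j (i' == j)%:R) conic.
  rewrite /der (bigD1 i') //= mxE eqxx mul1r big1 ?addr0 // => j ji.
  by rewrite mxE eq_sym (negPf ji) mul0r.
move: i vi; apply: ord3P => vi; [exists o0|exists o2|exists o1];
  rewrite d der_conic !mxE /= ?mulr0 ?mulr1 ?addr0 ?add0r ?mevalM ?mevalXU //.
by rewrite mevalC mulf_neq0 // char0.
Qed.

Lemma same_locus_sym p r : same_locus p r -> same_locus r p.
Proof. by move=> e v; split=> [/e|/e]. Qed.

Lemma separated p r a b c : p.@[pt a b c] = 0 -> r.@[pt a b c] != 0 ->
  ~ same_locus p r.
Proof. by move=> p0 r0 /(_ (pt a b c))[/(_ p0) e _]; rewrite e eqxx in r0. Qed.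

Lemma lines_differ a b : a != b -> ~ same_locus (line a) (line b).
Proof.
move=> ab; apply: (@separated _ _ 1 0 (- a)); rewrite eval_line mulr0 mulr1 addr0.
  by rewrite subrr.
by rewrite subr_eq0 eq_sym.
Qed.

Lemma line_pencil_differ a u : a != 0 -> ~ same_locus (pencil u) (line a).
Proof.
move=> a0; apply: (@separated _ _ 1 0 0).
  by rewrite eval_pencil !mulr0 addr0.
by rewrite eval_line mulr0 mulr1 !addr0.
Qed.

Lemma line_conic_differ a : ~ same_locus (line a) conic.
Proof.
apply: (@separated _ _ 1 0 (- a)).
  by rewrite eval_line mulr0 mulr1 addr0 subrr.
by rewrite eval_conic expr1n mulr1 mul0r addr0 char0.
Qed.

Lemma pencil_conic_differ u : ~ same_locus (pencil u) conic.
Proof.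
apply: (@separated _ _ 1 0 0).
  by rewrite eval_pencil !mulr0 addr0.
by rewrite eval_conic expr1n mulr1 mul0r addr0 char0.
Qed.

Definition det2 u v : K := u.1 * v.2 - u.2 * v.1.

Lemma pencils_differ u v : det2 u v != 0 -> ~ same_locus (pencil u) (pencil v).
Proof.
move=> uv; apply: (@separated _ _ 0 u.2 (- u.1)); rewrite eval_pencil.
  by rewrite mulrN mulrC subrr.
by apply: contraNneq uv => e; rewrite /det2 -oppr_eq0; apply/eqP; rewrite -e; ring.
Qed.

Section Equation.

Variables (us : seq (K * K)) (sl : seq K).

Definition comps : seq S := conic :: map line sl ++ map pencil us.

Definition pencil_part : S := \prod_(u <- us) pencil u.
Definition line_part : S := \prod_(a <- sl) line a.

Lemma prod_comps : \prod_(p <- comps) p = conic * (line_part * pencil_part).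
Proof. by rewrite /comps big_cons big_cat !big_map. Qed.

Hypothesis us_nz : {in us, forall u, u != (0, 0)}.
Hypothesis us_uniq : uniq us.
Hypothesis us_det : {in us &, forall u v, u != v -> det2 u v != 0}.
Hypothesis sl_uniq : uniq sl.
Hypothesis sl_nz : {in sl, forall a, a != 0}.

(** The points (1 : 0 : - a), (1 : 0 : 0) and the points of the line x = 0
    separate the components. *)
Lemma comps_ok : components_ok comps.
Proof.
have refl p : same_locus p p by [].
split.
- rewrite /comps cons_uniq cat_uniq mem_cat negb_or; apply/and4P; split.
  + apply/andP; split; apply/mapP => -[x _ e].
      by apply: (@line_conic_differ x); rewrite -e.
    by apply: (@pencil_conic_differ x); rewrite -e.
  + rewrite map_inj_uniq // => a b e; apply/eqP/negPn/negP => /lines_differ.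
    by rewrite e; apply.
  + apply/hasPn => p /mapP[u _ ->]; apply/mapP => -[a /sl_nz a0 e].
    by apply: (@line_pencil_differ a u a0); rewrite e.
  + rewrite map_inj_in_uniq // => u v uin vin e; apply/eqP/negPn/negP => uv.
    by apply: (@pencils_differ u v); [exact: us_det | rewrite e].
- move=> p; rewrite in_cons mem_cat => /orP[/eqP ->|/orP[]].
  + by right; exact: conic_is_smooth.
  + by case/mapP => a _ ->; left; exact: line_is_line.
  by case/mapP => u /us_nz u0 ->; left; exact: pencil_is_line.
move=> p r; rewrite !in_cons !mem_cat.
case/orP=> [/eqP ->|/orP[/mapP[a ain ->]|/mapP[u uin ->]]];
  case/orP=> [/eqP ->|/orP[/mapP[b bin ->]|/mapP[v vin ->]]] ne.
- by rewrite eqxx in ne.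
- by move/same_locus_sym/line_conic_differ.
- by move/same_locus_sym/pencil_conic_differ.
- exact: line_conic_differ.
- by apply: lines_differ; apply: contraNneq ne => ->.
- by move/same_locus_sym; apply/line_pencil_differ/sl_nz.
- exact: pencil_conic_differ.
- exact/line_pencil_differ/sl_nz.
by apply/pencils_differ/us_det => //; apply: contraNneq ne => ->.
Qed.

Lemma conic_in_comps : conic \in comps. Proof. by rewrite in_cons eqxx. Qed.

Lemma line_in_comps : {in sl, forall a, line a \in comps}.
Proof. by move=> a ain; rewrite in_cons mem_cat map_f ?orbT. Qed.

Lemma pencil_in_comps : {in us, forall u, pencil u \in comps}.
Proof. by move=> u uin; rewrite in_cons mem_cat map_f ?orbT. Qed.

Definition config : S := \prod_(p <- comps) p.

Lemma prod_homog (I : eqType) (t : seq I) (F : I -> S) :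
  (forall x, F x \is 1.-homog) -> \prod_(x <- t) F x \is (size t).-homog.
Proof.
move=> hF; elim: t => [|x t IH]; first by rewrite big_nil dhomog1.
by rewrite big_cons; exact: (dhomogM (hF x) IH).
Qed.

Lemma config_homog : config \is (2 + (size sl + size us)).-homog.
Proof.
rewrite /config prod_comps; apply: dhomogM; first exact: conic_homog.
by apply: dhomogM; apply: prod_homog => x; rewrite ?line_homog ?pencil_homog.
Qed.

(** The determinant of d/dx, the Euler field and g. *)
Definition radial g : S := Y * g 0 o2 - Z * g 0 o1.

Lemma radialD g h : radial (g + h) = radial g + radial h.
Proof. by rewrite /radial !mxE; ring. Qed.

Lemma radialB g h : radial (g - h) = radial g - radial h.
Proof. by rewrite /radial !mxE; ring. Qed.

Lemma radialZ p g : radial (p *: g) = p * radial g.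
Proof. by rewrite /radial !mxE; ring. Qed.

Lemma radial_comb g p h r l :
  radial (g + p *: h + r *: l) = radial g + p * radial h + r * radial l.
Proof. by rewrite /radial !mxE; ring. Qed.

Lemma radial_syzygy_of d h p : radial (syzygy_of d h p) = d%:R%:MP * radial h.
Proof.
by rewrite /syzygy_of radialB !radialZ /radial /euler_der !vecE; ring.
Qed.

Lemma divides_constl p (c : K) r : c != 0 -> divides p (c%:MP * r) -> divides p r.
Proof.
move=> c0 [q qE]; exists (c^-1%:MP * q); rewrite -mulrA -qE mulrA -mpolyCM.
by rewrite mulVf // mpolyC1 mul1r.
Qed.

(** Along a line through (1 : 0 : 0) preserved by g, the three columns of the
    determinant lie in one plane, that of the line. *)
Lemma pencil_divides_radial g u : u != (0, 0) ->
  divides (pencil u) (der g (pencil u)) -> divides (pencil u) (radial g).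
Proof.
case: u => u1 u2; rewrite xpair_eqE negb_and der_pencil /= => nz dv.
have [u10|u10] := eqVneq u1 0.
  have u20 : u2 != 0 by move: nz; rewrite u10 eqxx.
  apply: (divides_constl u20).
  have -> : u2%:MP * radial g = Y * (u1%:MP * g 0 o1 + u2%:MP * g 0 o2)
      - g 0 o1 * pencil (u1, u2) by rewrite /radial /pencil /=; ring.
  by apply: dividesB; apply: divides_mull => //; exact: divides_refl.
apply: (divides_constl u10).
have -> : u1%:MP * radial g = g 0 o2 * pencil (u1, u2)
   - Z * (u1%:MP * g 0 o1 + u2%:MP * g 0 o2) by rewrite /radial /pencil /=; ring.
by apply: dividesB; apply: divides_mull => //; exact: divides_refl.
Qed.

Local Notation d := (2 + (size sl + size us))%N.

(** The components avoiding (1 : 0 : 0). *)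
Definition transversal_part : S := conic * line_part.

Lemma config_split : config = transversal_part * pencil_part.
Proof. by rewrite /config prod_comps mulrA. Qed.

(** The field [transversal_part] d/dx is logarithmic since the equations of the
    lines of the pencil do not involve x. *)
Definition vertical_syzygy : 'rV[S]_3 :=
  syzygy_of d (vec transversal_part 0 0) (mderiv o0 transversal_part).

Lemma der_vertical p r : der (vec p 0 0) r = p * mderiv o0 r.
Proof. by rewrite derE !vecE; ring. Qed.

Lemma mderiv_pencil_part : mderiv o0 pencil_part = 0.
Proof.
rewrite -[LHS]mul1r -der_vertical /pencil_part.
elim/big_rec: _ => [|u p _ IH]; first by rewrite -mpolyC1 derC.
by rewrite derM IH der_pencil !vecE; ring.
Qed.

Lemma mderiv_config : mderiv o0 config = mderiv o0 transversal_part * pencil_part.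
Proof. by rewrite config_split mderivM mderiv_pencil_part mulr0 addr0. Qed.

Lemma vertical_syzygyP : jacobian_syzygy config vertical_syzygy.
Proof.
apply: syzygy_ofP; first exact: config_homog.
by rewrite der_vertical mderiv_config config_split; ring.
Qed.

Lemma transversal_homog : transversal_part \is (2 + size sl).-homog.
Proof. by apply: dhomogM conic_homog _; apply: prod_homog => a; exact: line_homog. Qed.

Lemma vertical_syzygy_homog : homogeneous_of_degree (2 + size sl) vertical_syzygy.
Proof.
have hg := transversal_homog.
apply: syzygy_of_homog; last exact: mderiv_homog hg.
by apply: ord3P; rewrite vecE ?rpred0.
Qed.

Lemma transversal_sub : {subset conic :: map line sl <= comps}.
Proof. by move=> r; rewrite !in_cons mem_cat => /orP[->|->] //; rewrite orbT. Qed.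

Lemma divides_transversal r : r \in conic :: map line sl ->
  divides r transversal_part.
Proof.
rewrite in_cons => /orP[/eqP ->|/mapP[a ain ->]].
  exact/divides_mulr/divides_refl.
apply: divides_mull; rewrite /line_part (bigD1_seq a) //=.
exact/divides_mulr/divides_refl.
Qed.

Lemma transversal_divides p :
  (forall r, r \in conic :: map line sl -> divides r p) ->
  divides transversal_part p.
Proof.
move=> dv; rewrite /transversal_part /line_part -(big_map line xpredT id).
rewrite -(big_cons _ _ conic _ xpredT id).
have sub := transversal_sub.
apply: prod_primes_divides => //.
- have [] := comps_ok; rewrite /comps -cat_cons cat_uniq => /andP[-> //].
- by move=> r /sub; apply: ok_prime comps_ok _.
by move=> r q /sub rin /sub qin; apply: (ok_ndivides comps_ok).
Qed.

Lemma config_neq0 : config != 0.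
Proof.
rewrite /config prodf_seq_neq0; apply/allP => p pin.
by have [] := ok_prime comps_ok pin.
Qed.

Lemma curve_degree_config : curve_degree config = d.
Proof. by rewrite /curve_degree (homog_msizeS config_homog config_neq0). Qed.

Lemma pencil_part_neq0 : pencil_part != 0.
Proof.
rewrite /pencil_part prodf_seq_neq0; apply/allP => u /us_nz u0.
by have [] := pencil_is_line u0.
Qed.

Lemma transversal_neq0 : transversal_part != 0.
Proof. by have := config_neq0; rewrite config_split mulf_eq0 negb_or; case/andP. Qed.

Lemma radial_vertical : radial vertical_syzygy = 0.
Proof. by rewrite radial_syzygy_of /radial !vecE; ring. Qed.

Lemma vertical_torsionfree p : p *: vertical_syzygy = 0 -> p = 0.
Proof.
move=> z; have := congr1 (fun g => X * g 0 o1 - Y * g 0 o0) z.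
rewrite !mxE /= /euler_der => e.
have {}e : p * (d%:R%:MP * (Y * transversal_part)) = 0.
  by move: e; rewrite !mulr0 subrr => e; rewrite -[RHS]oppr0 -e; ring.
apply/eqP; move/eqP: e; apply: contraTT => p0.
by rewrite 3?mulf_neq0 ?X_neq0 ?transversal_neq0 // mpolyC_eq0 char0.
Qed.

(** The field g is the sum of a multiple of the Euler field and of a field c d/dx.
    The derivative by x of a component r avoiding (1 : 0 : 0) is nonzero and of
    smaller degree than r, so r divides c. *)
Lemma radial_eq0 g : jacobian_syzygy config g -> radial g = 0 ->
  exists c, g = c *: vertical_syzygy.
Proof.
move=> gs /eqP; rewrite subr_eq0 => /eqP rad.
have [_ _ YP] := line_prime (X_homog o1) (X_neq0 o1).
have [e eE] : divides Y (g 0 o1).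
  have [|[q /(congr1 (fun p : S => p.@[pt 0 0 1]))]|//] := YP Z (g 0 o1).
    by exists (g 0 o2); rewrite -rad mulrC.
  by rewrite mevalM !mevalXU mulr0 => /eqP; rewrite oner_eq0.
have eZ : g 0 o2 = e * Z.
  by apply: (mulfI (X_neq0 o1)); rewrite rad eE; ring.
pose c := g 0 o0 - e * X.
have gE : g = e *: euler_der K + vec c 0 0.
  by apply: row3P; rewrite !mxE /= ?eE ?eZ /c /euler_der; ring.
have cE : e * d%:R%:MP * transversal_part = - (c * mderiv o0 transversal_part).
  apply/eqP; rewrite -addr_eq0.
  rewrite -(inj_eq (mulIf pencil_part_neq0)) mul0r; apply/eqP.
  rewrite -gs -/(der _ _) gE derDl derZl (der_euler config_homog) der_vertical.
  by rewrite mderiv_config config_split; ring.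
have [k kE] : divides transversal_part c.
  apply: transversal_divides => r rin.
  have rc : r \in comps by exact: transversal_sub.
  have [r0 _ rP] := ok_prime comps_ok rc.
  have [a [aE nda]] := ok_split comps_ok rc.
  have [j [hj rx]] : exists j, r \is j.+1.-homog /\ mderiv o0 r != 0.
    move: rin; rewrite in_cons => /orP[/eqP ->|/mapP[b bin ->]].
      exists 1%N; split; first exact: conic_homog.
      rewrite -[mderiv _ _]mul1r -der_vertical der_conic !vecE !mulr0 !addr0 mulr1.
      by rewrite mulf_neq0 ?X_neq0 // mpolyC_eq0 char0.
    exists 0%N; split; first exact: line_homog.
    rewrite -[mderiv _ _]mul1r -der_vertical der_line !vecE !mulr0 !addr0 mulr1.
    by rewrite mpolyC_eq0 sl_nz.
  have ndx : ~ divides r (mderiv o0 r).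
    move/divides_msize => /(_ rx).
    by rewrite (homog_msizeS hj r0) (homog_msizeS (mderiv_homog o0 hj) rx) ltnn.
  have : divides r (c * mderiv o0 r * a).
    have -> : c * mderiv o0 r * a =
        c * mderiv o0 config - c * mderiv o0 a * r.
      by rewrite /config aE mderivM; ring.
    apply: dividesB; last exact/divides_mull/divides_refl.
    rewrite mderiv_config mulrA; apply: divides_mulr.
    rewrite -[c * _]opprK -cE; apply/dividesN/divides_mull.
    exact: divides_transversal.
  by case/rP => // /rP[].
have d0 : d%:R != 0 :> K by rewrite char0.
have [Di DiE] : exists Di : S, Di * d%:R%:MP = 1.
  by exists (d%:R^-1)%:MP; rewrite -mpolyCM mulVf ?mpolyC1.
have T0 := transversal_neq0.
have eE' : e = - (Di * k * mderiv o0 transversal_part).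
  apply: (mulIf T0); rewrite -[LHS]mul1r -DiE.
  transitivity (Di * (e * d%:R%:MP * transversal_part)); first by ring.
  by rewrite cE kE; ring.
exists (Di * k).
have c1 : c = Di * d%:R%:MP * k * transversal_part by rewrite DiE mul1r.
rewrite gE eE' c1 /vertical_syzygy /syzygy_of; apply: row3P; rewrite !mxE /= /euler_der; ring.
Qed.

End Equation.
End Configuration.

(** * Irredundant generators *)

Section Generators.

Variable K : closedFieldType.
Local Notation S := {mpoly K[3]}.
Implicit Types (f p r : S) (g h : 'rV[S]_3).

(** The lemma of Nakayama in its graded form: a redundant generator yields a
    relation in which its coefficient is - 1. *)
Lemma irredundant_generators (D : 'rV[S]_3 -> Prop) m (G : 'I_m -> 'rV[S]_3) :
  (forall i, D (G i)) ->
  (forall c : 'I_m -> S, \sum_i c i *: G i = 0 -> forall i, (c i)@_0%MM = 0) ->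
  forall J : {set 'I_m}, generates D G J -> J = [set: 'I_m].
Proof.
move=> GD rel J Jgen; apply/setP => i; rewrite in_setT; apply/negPn/negP => iJ.
have [c cE] := Jgen _ (GD i).
have := rel (fun j => (if j \in J then c j else 0) - (j == i)%:R) _ i.
rewrite (negPf iJ) eqxx sub0r mcoeffN mcoeff1 eqxx => H.
have : - 1 = 0 :> K.
  apply: H; under eq_bigr => j _ do rewrite scalerBl.
  rewrite sumrB; apply/eqP; rewrite subr_eq0; apply/eqP.
  rewrite [RHS](bigD1 i) //= eqxx scale1r.
  rewrite [X in _ + X]big1 => [|j /negPf ->]; last by rewrite scale0r.
  rewrite addr0 cE [RHS]big_mkcond; apply: eq_bigr => j _.
  by case: ifP => // _; rewrite scale0r.
by move/eqP; rewrite oppr_eq0 oner_eq0.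
Qed.

Lemma mderiv_homog0 n (p : {mpoly K[n]}) i : p \is 0.-homog -> mderiv i p = 0.
Proof.
move=> hp; apply/mpolyP => m; rewrite mcoeff_deriv mcoeff0.
by rewrite (dhomog_nemf_coeff hp) ?mul0rn //= mdegD mdeg1 addn1.
Qed.

Lemma der_homogS k l g p : homogeneous_of_degree k.+1 g -> p \is l.-homog ->
  der g p \is (k + l).-homog.
Proof.
move=> hg; case: l => [|l] hp; last by rewrite addnS -addSn; exact: der_homog.
by rewrite /der big1 ?rpred0 // => i _; rewrite mderiv_homog0 ?mulr0.
Qed.

Lemma homogeneous_basis f g h k l :
  jacobian_syzygy f g -> jacobian_syzygy f h ->
  homogeneous_of_degree k g -> homogeneous_of_degree l h ->
  (forall x, jacobian_syzygy f x -> exists a b, x = a *: g + b *: h) ->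
  (forall a b, a *: g + b *: h = 0 -> a = 0 /\ b = 0) ->
  has_type f (k%:Z + l%:Z + 1 - (curve_degree f)%:Z) /\ free_curve f.
Proof.
move=> gs hs; wlog kl : g h k l gs hs / (k <= l)%N.
  move=> wl hg hh gen ind; have [kl|/ltnW lk] := leqP k l; first exact: wl gen ind.
  rewrite [k%:Z + _]addrC; apply: wl hh hg _ _ => //.
    by move=> x /gen[a [b ->]]; exists b, a; rewrite addrC.
  by move=> a b; rewrite addrC => /ind[].
move=> hg hh gen ind.
pose G (i : 'I_2) := if i == ord0 then g else h.
have GE (c : 'I_2 -> S) : \sum_i c i *: G i = c ord0 *: g + c (lift ord0 ord0) *: h.
  by rewrite !big_ord_recl big_ord0 addr0.
have Gs i : jacobian_syzygy f (G i) by rewrite /G; case: ifP.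
have Ggen : generates (jacobian_syzygy f) G [set: 'I_2].
  move=> x /gen[a [b ->]]; exists (fun i => if i == ord0 then a else b).
  by under eq_bigl => i do rewrite in_setT; rewrite GE.
have Gind (c : 'I_2 -> S) : \sum_i c i *: G i = 0 -> forall i, c i = 0.
  rewrite GE => /ind[c0 c1] i; case: (unliftP ord0 i) => [j ->|-> //].
  by rewrite ord1.
split; last by exists 2, G.
exists k, l; split=> //; exists [::]; split; first by rewrite /= kl.
exists G; split=> //.
  by move=> i; case: (unliftP ord0 i) => [j ->|->] //; rewrite ord1.
by apply: irredundant_generators => // c c0 i; rewrite (Gind c c0) mcoeff0.
Qed.

End Generators.

(** * Free arrangements *)

Section FreeFamily.

Variable K : closedFieldType.
Hypothesis char0 : forall n, n.+1%:R != 0 :> K.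
Local Notation S := {mpoly K[3]}.
Local Notation X := ('X_o0 : S).
Local Notation Y := ('X_o1 : S).
Local Notation Z := ('X_o2 : S).

Lemma pencil_divides_radial_syzygy us (sl : seq K) g :
  {in us, forall u, u != (0, 0)} -> uniq us ->
  {in us &, forall u v, u != v -> det2 u v != 0} ->
  uniq sl -> {in sl, forall a, a != 0} ->
  jacobian_syzygy (config us sl) g -> divides (pencil_part us) (radial g).
Proof.
move=> us_nz us_uniq us_det sl_uniq sl_nz gs.
have ok := comps_ok char0 us_nz us_uniq us_det sl_uniq sl_nz.
apply: prod_primes_divides => //.
- by move=> u uin; apply: ok_prime ok _ (pencil_in_comps sl uin).
- move=> u v uin vin uv; apply: (ok_ndivides ok); rewrite ?pencil_in_comps //.
  by apply/eqP => e; apply: (pencils_differ (us_det u v uin vin uv)); rewrite e.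
move=> u uin; apply: pencil_divides_radial; first exact: us_nz.
by apply: (syzygy_logarithmic ok gs); apply: pencil_in_comps.
Qed.

(** The generator of a torus of automorphisms of the conic fixing the lines x = 0,
    y = 0 and z = 0. *)
Definition torus_der : 'rV[S]_3 := vec X (2%:R%:MP * Y) 0.

Lemma torus_conic : der torus_der (conic K) = 2%:R%:MP * conic K.
Proof.
rewrite der_conic !vecE /conic (_ : 4%:R = 2%:R + 2%:R) ?mpolyCD; first by ring.
by rewrite -natrD.
Qed.

Lemma torus_homog : homogeneous_of_degree 1 torus_der.
Proof. by apply: ord3P; rewrite vecE ?X_homog ?CX_homog ?rpred0. Qed.

Variable ws : seq (K * K).
Local Notation us := ((1, 0) :: (0, 1) :: ws).
Local Notation f := (config us [::]).
Local Notation C := (\prod_(u <- ws) pencil u).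
Hypothesis us_nz : {in us, forall u, u != (0, 0)}.
Hypothesis us_uniq : uniq us.
Hypothesis us_det : {in us &, forall u v, u != v -> det2 u v != 0}.

(** The radial part of a syzygy is divisible by y z C, and that of C times the
    torus field is - 2 y z C. *)
Lemma free_family_free : has_type f 0 /\ free_curve f.
Proof.
have nil_uniq : uniq (@nil K) by [].
have nil_nz : {in [::], forall a : K, a != 0} by [].
have ok := comps_ok char0 us_nz us_uniq us_det nil_uniq nil_nz.
have Y1 : pencil (1, 0) = Y by rewrite /pencil /= mpolyC0 mpolyC1; ring.
have Z1 : pencil (0, 1) = Z by rewrite /pencil /= mpolyC0 mpolyC1; ring.
have PE : pencil_part us = Y * Z * C.
  by rewrite /pencil_part !big_cons Y1 Z1 mulrA.
have fE : f = conic K * (Y * Z * C).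
  by rewrite /config prod_comps PE /line_part big_nil mul1r.
pose h := C *: torus_der.
pose e := 4%:R%:MP * C + der torus_der C.
have hC : C \is (size ws).-homog by apply: prod_homog => u; exact: pencil_homog.
have hE : der h f = e * f.
  rewrite /h derZl {1}fE !derM torus_conic !derX !vecE /e.
  rewrite (_ : 4%:R = 2%:R + 2%:R) ?mpolyCD -?natrD // fE; ring.
have hh : homogeneous_of_degree (size ws).+1 h.
  by move=> i; rewrite mxE -[(size ws).+1]addn1; apply: dhomogM hC (torus_homog i).
have he : e \is (size ws).-homog.
  apply: rpredD; first exact: (dhomogM (C_homog _) hC).
  exact: (der_homogS torus_homog hC).
set d := (2 + (size (@nil K) + size us))%N.
have d0 : d%:R != 0 :> K by exact: char0.
have [D DE] : exists D : S, D * (2%:R%:MP * d%:R%:MP) = 1.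
  exists (((2%:R * d%:R)^-1)%:MP); rewrite -!mpolyCM mulVf ?mpolyC1 //.
  by rewrite mulf_neq0 // char0.
have radh : radial (syzygy_of d h e) = - (2%:R%:MP * d%:R%:MP * (Y * Z * C)).
  by rewrite radial_syzygy_of /h radialZ /radial /torus_der !vecE; ring.
have [] := @homogeneous_basis K f (vertical_syzygy us [::]) (syzygy_of d h e)
  2 (size ws).+1.
- exact: vertical_syzygyP.
- by apply: syzygy_ofP hE; exact: config_homog.
- exact: (vertical_syzygy_homog us [::]).
- exact: syzygy_of_homog.
- move=> g gs.
  have [b bE] := pencil_divides_radial_syzygy us_nz us_uniq us_det nil_uniq nil_nz gs.
  pose g' := g + (D * b) *: syzygy_of d h e.
  have g's : jacobian_syzygy f g'.
    rewrite /jacobian_syzygy -/(der _ _) derDl derZl /der gs add0r.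
    by rewrite (syzygy_ofP (config_homog _ _) hE) mulr0.
  have [|c cE] := radial_eq0 char0 us_nz us_uniq us_det nil_uniq nil_nz g's.
    rewrite radialD radialZ radh bE PE.
    transitivity (b * (Y * Z * C) * (1 - D * (2%:R%:MP * d%:R%:MP))); first by ring.
    by rewrite DE subrr mulr0.
  by exists c, (- (D * b)); rewrite scaleNr -cE addrK.
- move=> a b ab0; have b0 : b = 0.
    have := congr1 (@radial K) ab0.
    rewrite radialD (radialZ a) (radialZ b) radial_vertical radh mulr0 add0r.
    rewrite /radial !mxE !mulr0 subrr -PE => /eqP; rewrite mulf_eq0 oppr_eq0 !mulf_eq0 !mpolyC_eq0.
    rewrite (negPf d0) (negPf (char0 1)) /=.
    by rewrite (negPf (pencil_part_neq0 us_nz)) orbF => /eqP.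
  split=> //; move: ab0; rewrite b0 scale0r addr0.
  exact: (vertical_torsionfree char0 us_nz us_uniq us_det nil_uniq nil_nz).
move=> ht hf; split=> //; move: ht.
rewrite (curve_degree_config char0 us_nz us_uniq us_det nil_uniq nil_nz).
by congr has_type; rewrite /=; lia.
Qed.

End FreeFamily.

(** * Restriction to a transversal line *)

Section Substitution.

Variable K : closedFieldType.
Local Notation S := {mpoly K[3]}.
Local Notation X := ('X_o0 : S).
Local Notation Y := ('X_o1 : S).
Local Notation Z := ('X_o2 : S).

Lemma mpoly_generated (n : nat) (P : {mpoly K[n]} -> Prop) :
  (forall c, P c%:MP) -> (forall i, P 'X_i) ->
  (forall p q, P p -> P q -> P (p + q)) ->
  (forall p q, P p -> P q -> P (p * q)) -> forall p, P p.
Proof.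
move=> PC PX PD PM; elim/mpolyind => [|c m p _ _ Pp].
  by rewrite -mpolyC0.
apply: (PD) => //; rewrite -mul_mpolyC; apply: (PM) => //; rewrite mpolyXE_id.
apply: big_ind => [||i _]; [by rewrite -mpolyC1 | exact: PM |].
elim: (m i) => [|k IH]; first by rewrite expr0 -mpolyC1.
by rewrite exprS; apply: PM.
Qed.

(** The generic point of the line a, with coordinates x and y. *)
Definition line_point a : 3.-tuple S :=
  [tuple X; Y; - (a%:MP * X + (a ^+ 2)%:MP * Y)].
Local Notation res a := (comp_mpoly (line_point a)).

Lemma res_congr a p : divides (line a) (p - res a p).
Proof.
elim/mpoly_generated: p => [c|i|p q pP qP|p q pP qP].
- by rewrite comp_mpolyC subrr; exact: divides0.
- rewrite comp_mpolyXU; move: i; apply: ord3P; rewrite /= ?subrr.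
  + exact: divides0.
  + exact: divides0.
  by exists 1; rewrite mul1r opprK /line; ring.
- rewrite comp_mpolyD (_ : _ - _ = (p - res a p) + (q - res a q)); last by ring.
  exact: dividesD.
rewrite rmorphM /= (_ : _ - _ = p * (q - res a q) + (p - res a p) * res a q); last by ring.
by apply: dividesD; [exact: divides_mull | exact: divides_mulr].
Qed.

Lemma resX a : res a X = X. Proof. by rewrite comp_mpolyXU. Qed.
Lemma resY a : res a Y = Y. Proof. by rewrite comp_mpolyXU. Qed.
Lemma resZ a : res a Z = - (a%:MP * X + (a ^+ 2)%:MP * Y).
Proof. by rewrite comp_mpolyXU. Qed.

Lemma resE a : (forall p q, res a (p + q) = res a p + res a q) *
  (forall p q, res a (p * q) = res a p * res a q) *
  (forall p, res a (- p) = - res a p) * (forall c, res a c%:MP = c%:MP) *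
  (res a X = X) * (res a Y = Y) * (res a Z = - (a%:MP * X + (a ^+ 2)%:MP * Y)).
Proof.
by do !split=> *; rewrite ?comp_mpolyC ?resX ?resY ?resZ ?rmorphD ?rmorphM ?rmorphN.
Qed.

(** Points of a line with coordinates x and y are given by linear forms. *)
Definition lin (u : K * K) : S := u.1%:MP * X + u.2%:MP * Y.

Lemma lin_prime u : u != (0, 0) -> prime_element (lin u).
Proof.
move=> u0; apply: line_prime; first by rewrite rpredD ?CX_homog.
apply: contraNneq u0 => e; apply/eqP; case: u e => u1 u2 e.
have := congr1 (fun p : S => p.@[pt 0 1 0]) e.
have := congr1 (fun p : S => p.@[pt 1 0 0]) e.
rewrite /lin !meval0 !mevalD !mevalM !mevalC !mevalXU /pt /=.
by rewrite !mulr0 !mulr1 add0r addr0 => -> ->.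
Qed.

Lemma lin_ndivides u v : det2 u v != 0 -> ~ divides (lin u) (lin v).
Proof.
move=> uv [r /(congr1 (fun p : S => p.@[pt u.2 (- u.1) 0]))].
rewrite /lin !mevalM !mevalD !mevalM !mevalC !mevalXU /pt /=.
move=> e; case/eqP: uv; rewrite /det2.
transitivity (- (v.1 * u.2 + v.2 * - u.1)); first by ring.
rewrite e; ring.
Qed.

Lemma det2C (u v : K * K) : det2 u v = - det2 v u.
Proof. by rewrite /det2; ring. Qed.

Lemma pairwise_sym_in (T : eqType) (r : rel T) (s : seq T) :
  (forall x y, r x y = r y x) -> pairwise r s -> {in s &, forall x y, x != y -> r x y}.
Proof.
move=> rC; elim: s => // x s IH /= /andP[/allP xs ps] y z.
rewrite !in_cons => /orP[/eqP ->|ys] /orP[/eqP ->|zs]; rewrite ?eqxx //.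
- by move=> _; exact: xs.
- by move=> _; rewrite rC; exact: xs.
exact: IH.
Qed.

Lemma prod_lin_divides (t : seq (K * K)) (p : S) :
  {in t, forall u, u != (0, 0)} -> pairwise (fun u v => det2 u v != 0) t ->
  {in t, forall u, divides (lin u) p} -> divides (\prod_(u <- t) lin u) p.
Proof.
move=> t0 tp td; apply: prod_primes_divides => //.
- rewrite uniq_pairwise; apply: sub_pairwise tp => u v.
  by apply: contraNneq => ->; rewrite /det2 mulrC subrr.
- by move=> u /t0; exact: lin_prime.
move=> u v ut vt uv; apply: lin_ndivides.
apply: (pairwise_sym_in _ tp) => // x y.
by rewrite det2C oppr_eq0.
Qed.

(** A planar field preserving a point is proportional to the Euler field there. *)
Lemma lin_divides_minor u (g0 g1 : S) : u != (0, 0) ->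
  divides (lin u) (u.1%:MP * g0 + u.2%:MP * g1) ->
  divides (lin u) (X * g1 - Y * g0).
Proof.
case: u => u1 u2; rewrite xpair_eqE negb_and /= => nz dv.
have [u10|u10] := eqVneq u1 0.
  have u20 : u2 != 0 by move: nz; rewrite u10 eqxx.
  apply: (divides_constl u20).
  have -> : u2%:MP * (X * g1 - Y * g0) =
     X * (u1%:MP * g0 + u2%:MP * g1) - g0 * lin (u1, u2) by rewrite /lin /=; ring.
  by apply: dividesB; apply: divides_mull => //; exact: divides_refl.
apply: (divides_constl u10).
have -> : u1%:MP * (X * g1 - Y * g0) =
   g1 * lin (u1, u2) - Y * (u1%:MP * g0 + u2%:MP * g1) by rewrite /lin /=; ring.
by apply: dividesB; apply: divides_mull => //; exact: divides_refl.
Qed.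

End Substitution.

Section LineRestriction.

Variable K : closedFieldType.
Hypothesis char0 : forall n, n.+1%:R != 0 :> K.
Local Notation S := {mpoly K[3]}.
Local Notation X := ('X_o0 : S).
Local Notation Y := ('X_o1 : S).
Local Notation Z := ('X_o2 : S).
Local Notation res a := (comp_mpoly (line_point a)).

Variables (us : seq (K * K)) (sl : seq K).
Hypothesis us_nz : {in us, forall u, u != (0, 0)}.
Hypothesis us_uniq : uniq us.
Hypothesis us_det : {in us &, forall u v, u != v -> det2 u v != 0}.
Hypothesis sl_uniq : uniq sl.
Hypothesis sl_nz : {in sl, forall a, a != 0}.
Implicit Types (a b : K) (u v : K * K).
Let ok := comps_ok char0 us_nz us_uniq us_det sl_uniq sl_nz.

(** Up to nonzero factors, the expressions are the determinants of pairs of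
    points in which line a meets the other components: these points are
    distinct. *)
Definition general_position : Prop :=
  [/\ {in sl &, forall a b, 2%:R * b + a != 0},
      {in sl & us, forall a u, 2%:R * u.1 - a ^+ 2 * u.2 != 0 /\
                               u.1 - 2%:R * a ^+ 2 * u.2 != 0} &
      forall a b u, a \in sl -> b \in sl -> u \in us -> a != b ->
                    u.1 + a * b * u.2 != 0].
Hypothesis gp : general_position.

Definition cofactor_line a : S :=
  conic K * (\prod_(b <- sl | b != a) line b) * pencil_part us.

Lemma config_line a : a \in sl -> config us sl = line a * cofactor_line a.
Proof.
move=> ain; rewrite /config prod_comps /line_part (bigD1_seq a) //= /cofactor_line.
ring.
Qed.

(** The intersections of line a with the other components; the first two lie on
    the conic. *)
Definition traces a : seq (K * K) :=
  [:: (2%:R, a); (1, - a)] ++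
  [seq (b - a, b ^+ 2 - a ^+ 2) | b <- [seq b <- sl | b != a]] ++
  [seq (- (a * u.2), u.1 - a ^+ 2 * u.2) | u <- us].

Lemma res_conic a : res a (conic K) = lin (2%:R, a) * lin (1, - a).
Proof.
rewrite /conic expr2 !resE /lin /= !mpolyCN mpolyC1 expr2 mpolyCM.
rewrite (_ : 2%:R%:MP = 1 + 1 :> S); first by ring.
by rewrite -mpolyC1 -mpolyCD -natr1.
Qed.

Lemma res_line a b : res a (line b) = lin (b - a, b ^+ 2 - a ^+ 2).
Proof. by rewrite /line !resE /lin /= !mpolyCB; ring. Qed.

Lemma res_pencil a u :
  res a (pencil u) = lin (- (a * u.2), u.1 - a ^+ 2 * u.2).
Proof. by rewrite /pencil !resE /lin /= mpolyCN mpolyCB !mpolyCM; ring. Qed.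

Lemma res_cofactor a : res a (cofactor_line a) = \prod_(u <- traces a) lin u.
Proof.
rewrite /cofactor_line /traces !big_cat /= !big_cons !big_nil !big_map big_filter mulr1.
rewrite 2!rmorphM /= res_conic [RHS]mulrA; congr (_ * _ * _);
  rewrite rmorph_prod; apply: eq_bigr => x _.
  exact: res_line.
exact: res_pencil.
Qed.

Lemma traces_pairwise a : a \in sl ->
  pairwise (fun u v => det2 u v != 0) (traces a).
Proof.
have [gpl gpc gpp] := gp; move=> ain.
have a0 := sl_nz ain.
have subn0 b : b != a -> b - a != 0 by rewrite subr_eq0.
have nz2 x y : x != 0 -> y != 0 -> x * y != 0 :> K by move=> *; rewrite mulf_neq0.
have to_nz (x y : K) : x = y -> y != 0 -> x != 0 by move=> ->.
rewrite /traces !pairwise_cat !allrel_catr /=.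
rewrite andbT; apply/and3P; split.
- apply/andP; split; apply/allrelP => x y.
    rewrite !inE => /orP[] /eqP -> /mapP[b]; rewrite mem_filter => /andP[ba bin] ->.
      apply: (to_nz _ ((b - a) * (2%:R * b + a))); first by rewrite /det2 /=; ring.
      by rewrite nz2 ?subn0 ?gpl.
    apply: (to_nz _ ((b - a) * (2%:R * a + b))); first by rewrite /det2 /=; ring.
    by rewrite nz2 ?subn0 ?gpl.
  rewrite !inE => /orP[] /eqP -> /mapP[u uin ->]; have [g1 g2] := gpc a u ain uin.
    by apply: (to_nz _ _ _ g1); rewrite /det2 /=; ring.
  by apply: (to_nz _ _ _ g2); rewrite /det2 /=; ring.
- rewrite andbT /det2 /=; apply: (to_nz _ (- (3%:R * a))); first by ring.
  by rewrite oppr_eq0 nz2 ?char0.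
apply/and3P; split.
- apply/allrelP => x y /mapP[b]; rewrite mem_filter => /andP[ba bin] -> /mapP[u uin ->].
  apply: (to_nz _ ((b - a) * (u.1 + a * b * u.2))); first by rewrite /det2 /=; ring.
  by rewrite nz2 ?subn0 ?gpp // eq_sym.
- rewrite pairwise_map;
  apply: (@sub_in_pairwise _ (mem [seq b <- sl | b != a]) [rel x y | x != y]).
  + move=> b c; rewrite !mem_filter => /andP[ba _] /andP[ca _] /= bc.
    apply: (to_nz _ ((b - a) * (c - a) * (c - b))); first by rewrite /det2 /=; ring.
    by rewrite !nz2 ?subn0 // subr_eq0 eq_sym.
  + by apply/allP.
  + by rewrite -uniq_pairwise filter_uniq.
rewrite pairwise_map; apply: (@sub_in_pairwise _ (mem us) [rel x y | x != y]).
- move=> u v uin vin /= uv; apply: (to_nz _ (a * det2 u v)); first by rewrite /det2 /=; ring.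
  by rewrite nz2 ?us_det.
- by apply/allP.
by rewrite -uniq_pairwise.
Qed.

Lemma traces_nz a : a \in sl -> {in traces a, forall u, u != (0, 0)}.
Proof.
move=> ain u; have a0 := sl_nz ain.
rewrite /traces !mem_cat !inE => /or3P[/orP[] /eqP ->|/mapP[b]|/mapP[v vin ->]].
- by rewrite xpair_eqE negb_and char0.
- by rewrite xpair_eqE negb_and oner_eq0.
- by rewrite mem_filter => /andP[ba _] ->; rewrite xpair_eqE negb_and subr_eq0 ba.
have := us_nz vin; case: v {vin} => v1 v2; rewrite !xpair_eqE /=; apply: contra.
rewrite oppr_eq0 mulf_eq0 (negPf a0) /= => /andP[/eqP -> ].
by rewrite mulr0 subr0 eqxx => ->.
Qed.

(** On line a the field g becomes a planar field (g0, g1) preserving all traces, and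
    the radial part of g becomes a times its determinant with the Euler field,
    which is divisible by the product of the traces. *)
Lemma radial_on_line g a : jacobian_syzygy (config us sl) g -> a \in sl ->
  exists c : S, divides (line a) (radial g - c * cofactor_line a).
Proof.
move=> gs ain; have logg := syzygy_logarithmic ok gs.
pose g0 := res a (g 0 o0); pose g1 := res a (g 0 o1); pose g2 := res a (g 0 o2).
have res_dv p q : divides p q -> divides (res a p) (res a q).
  by case=> r ->; exists (res a r); rewrite resE.
have g2E : g2 = - (a%:MP * g0 + (a ^+ 2)%:MP * g1).
  have := res_dv _ _ (logg _ (line_in_comps us ain)).
  rewrite res_line !subrr /lin /= mpolyC0 !mul0r addr0 => -[r].
  rewrite mulr0 der_line !resE -/g0 -/g1 -/g2 => e.
  by apply/eqP; rewrite -addr_eq0 addrC; apply/eqP.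
have radE : res a (radial g) = a%:MP * (X * g1 - Y * g0).
  by rewrite /radial !resE -/g1 -/g2 g2E expr2 mpolyCM; ring.
have dv u : u \in traces a -> divides (lin u) (X * g1 - Y * g0).
  move=> uin; apply: lin_divides_minor; first exact: traces_nz uin.
  move: uin; rewrite /traces !mem_cat => /or3P[].
  - have a0 := sl_nz ain.
    have := res_dv _ _ (logg _ (conic_in_comps us sl)).
    rewrite res_conic der_conic !resE -/g0 -/g1 -/g2 g2E expr2 mpolyCM.
    (* The restriction of g(q) vanishes on both points of the conic; the product
       rule separates the two conditions. *)
    set q := (X in divides _ X) => qd.
    have qE : q = lin (2%:R, a) * (1%:MP * g0 + (- a)%:MP * g1)
        + lin (1, - a) * (2%:R%:MP * g0 + a%:MP * g1).
      rewrite /q /lin /= mpolyCN mpolyC1 (_ : 4%:R = 2%:R + 2%:R) -?natrD //.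
      rewrite mpolyCD (_ : 2%:R%:MP = 1 + 1 :> S); first by ring.
      by rewrite -mpolyC1 -mpolyCD -natr1.
    have det3 : det2 (2%:R, a) (1, - a) != 0.
      rewrite /det2 /= (_ : _ - _ = - (3%:R * a)); last by ring.
      by rewrite oppr_eq0 mulf_neq0.
    rewrite !inE => /orP[] /eqP -> /=.
      have [|[_ _ lP]] := @lin_prime K (2%:R, a); first by rewrite xpair_eqE negb_and char0.
      have : divides (lin (2%:R, a)) (lin (1, - a) * (2%:R%:MP * g0 + a%:MP * g1)).
        rewrite -[_ * _](addKr (lin (2%:R, a) * (1%:MP * g0 + (- a)%:MP * g1))) -qE.
        rewrite addrC; apply: dividesB; last exact/divides_mulr/divides_refl.
        by apply: divides_trans qd; exact/divides_mulr/divides_refl.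
      by case/lP => // /(lin_ndivides det3).
    have [|_ _ lP] := @lin_prime K (1, - a); first by rewrite xpair_eqE negb_and oner_eq0.
    have : divides (lin (1, - a)) (lin (2%:R, a) * (1%:MP * g0 + (- a)%:MP * g1)).
      rewrite -[_ * _](addrK (lin (1, - a) * (2%:R%:MP * g0 + a%:MP * g1))) -qE.
      apply: dividesB; last exact/divides_mulr/divides_refl.
      by apply: divides_trans qd; exact/divides_mull/divides_refl.
    by case/lP => //; case/lin_ndivides; rewrite det2C oppr_eq0.
  - move=> /mapP[b]; rewrite mem_filter => /andP[ba bin] -> /=.
    have := res_dv _ _ (logg _ (line_in_comps us bin)).
    rewrite res_line der_line !resE -/g0 -/g1 -/g2 g2E !mpolyCB.
    by congr divides; ring.
  move=> /mapP[v vin ->] /=.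
  have := res_dv _ _ (logg _ (pencil_in_comps sl vin)).
  rewrite res_pencil der_pencil !resE -/g0 -/g1 -/g2 g2E mpolyCN mpolyCB !mpolyCM.
  by congr divides; ring.
have [r rE] : divides (res a (cofactor_line a)) (X * g1 - Y * g0).
  rewrite res_cofactor; apply: prod_lin_divides => //.
    exact: traces_nz.
  exact: traces_pairwise.
exists (a%:MP * r).
rewrite (_ : _ - _ = (radial g - res a (radial g))
   - (a%:MP * r) * (cofactor_line a - res a (cofactor_line a))).
  by apply: dividesB; [|apply: divides_mull]; exact: res_congr.
by rewrite radE rE; ring.
Qed.
End LineRestriction.

(** * Generators in positive type *)

Section Family.

Variable K : closedFieldType.
Hypothesis char0 : forall n, n.+1%:R != 0 :> K.
Local Notation S := {mpoly K[3]}.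
Local Notation X := ('X_o0 : S).
Local Notation Y := ('X_o1 : S).
Local Notation Z := ('X_o2 : S).

Lemma syzygyD (f : S) g h : jacobian_syzygy f g -> jacobian_syzygy f h ->
  jacobian_syzygy f (g + h).
Proof. by rewrite /jacobian_syzygy -!/(der _ _) derDl => -> ->; rewrite addr0. Qed.

Lemma syzygyZ (f c : S) g : jacobian_syzygy f g -> jacobian_syzygy f (c *: g).
Proof. by rewrite /jacobian_syzygy -!/(der _ _) derZl => ->; rewrite mulr0. Qed.

Lemma radial_sum (I : Type) (s : seq I) (G : I -> 'rV[S]_3) :
  radial (\sum_(x <- s) G x) = \sum_(x <- s) radial (G x).
Proof.
elim: s => [|x s IH]; last by rewrite !big_cons radialD IH.
by rewrite !big_nil /radial !mxE !mulr0 subrr.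
Qed.

(** The point (0 : 1 : 0), where z = 0 touches the conic. *)
Definition tangency_point : 3.-tuple S := [tuple 0; Y; 0].
Local Notation at_tangency := (comp_mpoly tangency_point).

Lemma at_tangency_congr (p : S) :
  exists r s : S, p - at_tangency p = r * X + s * Z.
Proof.
elim/mpoly_generated: p => [c|i|p q [r [s e]] [r' [s' e']]|p q [r [s e]] [r' [s' e']]].
- by exists 0, 0; rewrite comp_mpolyC subrr; ring.
- rewrite comp_mpolyXU; move: i; apply: ord3P; rewrite /=.
  + by exists 1, 0; ring.
  + by exists 0, 0; ring.
  + by exists 0, 1; ring.
- exists (r + r'), (s + s'); rewrite comp_mpolyD.
  transitivity ((p - at_tangency p) + (q - at_tangency q)); first by ring.
  by rewrite e e'; ring.
exists (p * r' + r * at_tangency q), (p * s' + s * at_tangency q); rewrite rmorphM /=.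
transitivity (p * (q - at_tangency q) + (p - at_tangency p) * at_tangency q); first by ring.
by rewrite e e'; ring.
Qed.

Variables (ws : seq (K * K)) (sl : seq K).
Implicit Types (a b : K) (u v : K * K) (g h : 'rV[S]_3).
Local Notation us := ((1, 0) :: ws).
Local Notation f := (config us sl).
Local Notation d := (2 + (size sl + size us))%N.
Local Notation k := (size sl + size ws)%N.
Hypothesis us_nz : {in us, forall u, u != (0, 0)}.
Hypothesis us_uniq : uniq us.
Hypothesis us_det : {in us &, forall u v, u != v -> det2 u v != 0}.
Hypothesis sl_uniq : uniq sl.
Hypothesis sl_nz : {in sl, forall a, a != 0}.
Hypothesis us_fst : {in us, forall u, u.1 != 0}.
Hypothesis gp : general_position us sl.
Let ok := comps_ok char0 us_nz us_uniq us_det sl_uniq sl_nz.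

(** The lines other than the tangent y = 0 of the conic. *)
Definition other_pencil : S := \prod_(u <- ws) pencil u.
Definition other_lines : S := line_part sl * other_pencil.

Lemma pencil_tangent : pencil (1, 0) = Y :> S.
Proof. by rewrite /pencil /= mpolyC0 mpolyC1; ring. Qed.

Lemma pencil_partE : pencil_part us = Y * other_pencil.
Proof. by rewrite /pencil_part big_cons pencil_tangent. Qed.

Lemma configE : f = conic K * (Y * other_lines).
Proof. by rewrite /config prod_comps pencil_partE /other_lines; ring. Qed.

Lemma other_lines_homog : other_lines \is k.-homog.
Proof.
by apply: dhomogM; apply: prod_homog => x; rewrite ?line_homog ?pencil_homog.
Qed.

(** An infinitesimal automorphism of the conic fixing its tangent y = 0. Multiplied
    by the remaining lines it becomes logarithmic for the arrangement. *)
Definition rotation_der : 'rV[S]_3 := vec (- Y) 0 (4%:R%:MP * X).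

Lemma rotation_conic : der rotation_der (conic K) = 0.
Proof. by rewrite der_conic !vecE; ring. Qed.

Lemma rotation_homog : homogeneous_of_degree 1 rotation_der.
Proof. by apply: ord3P; rewrite vecE ?rpredN ?X_homog ?CX_homog ?rpred0. Qed.

Definition rotation_syzygy : 'rV[S]_3 :=
  syzygy_of d (other_lines *: rotation_der) (der rotation_der other_lines).

Definition torus_syzygy : 'rV[S]_3 :=
  syzygy_of d (other_lines *: torus_der K)
    (4%:R%:MP * other_lines + der (torus_der K) other_lines).

Lemma rotation_syzygyP : jacobian_syzygy f rotation_syzygy.
Proof.
apply: syzygy_ofP; first exact: config_homog.
rewrite derZl {1}configE !derM rotation_conic derX vecE configE; ring.
Qed.

Lemma torus_syzygyP : jacobian_syzygy f torus_syzygy.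
Proof.
apply: syzygy_ofP; first exact: config_homog.
rewrite derZl {1}configE !derM torus_conic derX vecE configE.
by rewrite (_ : 4%:R = 2%:R + 2%:R) ?mpolyCD -?natrD //; ring.
Qed.

Lemma scaled_homog l (p : S) g : p \is l.-homog -> homogeneous_of_degree 1 g ->
  homogeneous_of_degree l.+1 (p *: g).
Proof. by move=> hp hg i; rewrite mxE -[l.+1]addn1; apply: dhomogM. Qed.

Lemma rotation_syzygy_homog : homogeneous_of_degree k.+1 rotation_syzygy.
Proof.
apply: syzygy_of_homog.
  exact: scaled_homog other_lines_homog rotation_homog.
exact: (der_homogS rotation_homog other_lines_homog).
Qed.

Lemma torus_syzygy_homog : homogeneous_of_degree k.+1 torus_syzygy.
Proof.
apply: syzygy_of_homog; first exact: scaled_homog other_lines_homog (@torus_homog K).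
apply: rpredD; first exact: (dhomogM (C_homog _) other_lines_homog).
exact: (der_homogS (@torus_homog K) other_lines_homog).
Qed.

Lemma radial_rotation :
  radial rotation_syzygy = d%:R%:MP * (4%:R%:MP * X * (Y * other_lines)).
Proof. by rewrite radial_syzygy_of radialZ /radial /rotation_der !vecE; ring. Qed.

Lemma radial_torus :
  radial torus_syzygy = d%:R%:MP * (- (2%:R%:MP * Z * (Y * other_lines))).
Proof. by rewrite radial_syzygy_of radialZ /radial /torus_der !vecE; ring. Qed.

(** In the chart y = 1, the constant field along line a is multiplied by the other
    components. The line y = 0 is preserved by the constant field itself. *)
Definition line_factor a : S :=
  conic K * ((\prod_(b <- sl | b != a) line b) * other_pencil).

Definition direction a : 'rV[S]_3 := vec (-1) 0 a%:MP.

Definition line_syzygy a : 'rV[S]_3 :=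
  syzygy_of d (line_factor a *: direction a) (der (direction a) (line_factor a)).

Lemma cofactor_lineE a : cofactor_line us sl a = Y * line_factor a.
Proof. by rewrite /cofactor_line pencil_partE /line_factor; ring. Qed.

Lemma line_syzygyP a : a \in sl -> jacobian_syzygy f (line_syzygy a).
Proof.
move=> ain; apply: syzygy_ofP; first exact: config_homog.
rewrite derZl (config_line us sl_uniq ain) cofactor_lineE !derM derX.
by rewrite der_line !vecE; ring.
Qed.

Lemma line_factor_homog a : a \in sl -> line_factor a \is k.+1.-homog.
Proof.
move=> ain; have slpos : (0 < size sl)%N by case: (sl) ain.
have -> : k.+1 = (2 + ((size sl).-1 + size ws))%N by lia.
apply: dhomogM; first exact: conic_homog.
apply: dhomogM; last by apply: prod_homog => u; exact: pencil_homog.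
rewrite -big_filter -(size_rem ain) rem_filter //.
by apply: prod_homog => b; exact: line_homog.
Qed.

Lemma line_syzygy_homog a : a \in sl -> homogeneous_of_degree k.+1 (line_syzygy a).
Proof.
move=> ain; have hF := line_factor_homog ain.
have hd : homogeneous_of_degree 0 (direction a).
  by apply: ord3P; rewrite vecE ?rpred0 ?rpredN ?dhomog1 ?C_homog.
apply: syzygy_of_homog.
  by move=> i; rewrite mxE -[k.+1]addn0; apply: dhomogM.
exact: (der_homog hd hF).
Qed.

Lemma radial_line a :
  radial (line_syzygy a) = d%:R%:MP * (a%:MP * cofactor_line us sl a).
Proof.
rewrite radial_syzygy_of radialZ /radial /direction !vecE cofactor_lineE; ring.
Qed.

Lemma line_divides_cofactor a b : a \in sl -> a != b ->
  divides (line a) (cofactor_line us sl b).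
Proof.
move=> ain ab; rewrite cofactor_lineE /line_factor; apply/divides_mull/divides_mull.
rewrite -big_filter (bigD1_seq a) ?mem_filter ?ab ?filter_uniq //= -mulrA.
exact/divides_mulr/divides_refl.
Qed.

Lemma line_divides_other a : a \in sl -> divides (line a) other_lines.
Proof.
move=> ain; rewrite /other_lines /line_part (bigD1_seq a) //= -!mulrA.
exact/divides_mulr/divides_refl.
Qed.

Lemma line_ndivides_cofactor a : a \in sl -> ~ divides (line a) (cofactor_line us sl a).
Proof.
move=> ain; have lin := line_in_comps us ain.
have [p [pE ndp]] := ok_split ok lin; have [l0 _ _] := ok_prime ok lin.
by move: pE; rewrite -/f (config_line us sl_uniq ain) => /(mulfI l0) ->.
Qed.

Lemma d_inv (c : K) : c != 0 -> exists D : S, D * (d%:R%:MP * c%:MP) = 1.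
Proof.
move=> c0; exists ((d%:R * c)^-1)%:MP.
by rewrite -!mpolyCM mulVf ?mpolyC1 // mulf_neq0 // char0.
Qed.

Lemma lines_divide_radial g : jacobian_syzygy f g ->
  {in sl, forall a, divides (line a) (radial g)} ->
  divides (Y * other_lines) (radial g).
Proof.
move=> gs gl; have -> : Y * other_lines = \prod_(p <- map (@line K) sl ++ map (@pencil K) us) p.
  rewrite /other_lines /line_part /other_pencil big_cat !big_map big_cons.
  by rewrite pencil_tangent /=; ring.
have sub : {subset map (@line K) sl ++ map (@pencil K) us <= comps us sl}.
  by move=> p pin; rewrite in_cons pin orbT.
have [/= /andP[_ uc] _ _] := ok.
apply: prod_primes_divides => //.
- by move=> p /sub; apply: ok_prime ok _.
- by move=> p q /sub pin /sub qin; apply: (ok_ndivides ok).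
move=> p; rewrite mem_cat => /orP[/mapP[a ain ->]|pin]; first exact: gl.
have /mapP[u uin ->] : p \in map (@pencil K) us by [].
apply: pencil_divides_radial; first exact: us_nz.
by apply: (syzygy_logarithmic ok gs); apply: pencil_in_comps.
Qed.

(** A field preserving the conic preserves its tangent z = 0 at (0 : 1 : 0), so the
    radial part vanishes at this point; the lines of the arrangement do not
    pass through it. *)
Lemma tangency_ideal g (c : S) : jacobian_syzygy f g ->
  radial g = c * (Y * other_lines) -> exists r s : S, c = r * X + s * Z.
Proof.
move=> gs gE; have [r [s e]] := at_tangency_congr c; exists r, s.
suff c0 : at_tangency c = 0 by rewrite -e c0 subr0.
have tX : at_tangency X = 0 by rewrite comp_mpolyXU.
have tY : at_tangency Y = Y by rewrite comp_mpolyXU.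
have tZ : at_tangency Z = 0 by rewrite comp_mpolyXU.
have g2 : at_tangency (Y * g 0 o2) = 0.
  have [q qE] := syzygy_logarithmic ok gs (conic_in_comps us sl).
  have := congr1 at_tangency qE; rewrite der_conic /conic expr2.
  rewrite !(rmorphD, rmorphM) /= !comp_mpolyC tX tY tZ.
  by rewrite !(mulr0, mul0r, add0r, addr0).
have ol0 : at_tangency (Y * other_lines) != 0.
  rewrite rmorphM /= tY mulf_neq0 ?X_neq0 // /other_lines rmorphM mulf_neq0 //=.
    rewrite rmorph_prod prodf_seq_neq0; apply/allP => a ain /=.
    rewrite /line !comp_mpolyD !(rmorphM (comp_mpoly tangency_point)) /=.
    rewrite !comp_mpolyC tX tY tZ mulr0 add0r addr0.
    by rewrite mulf_neq0 ?X_neq0 // mpolyC_eq0 expf_neq0 // sl_nz.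
  rewrite rmorph_prod prodf_seq_neq0; apply/allP => u uin /=.
  rewrite /pencil !comp_mpolyD !(rmorphM (comp_mpoly tangency_point)) /=.
  rewrite !comp_mpolyC tY tZ mulr0 addr0.
  by rewrite mulf_neq0 ?X_neq0 // mpolyC_eq0 us_fst // in_cons uin orbT.
apply: (mulIf ol0); rewrite mul0r -rmorphM /= -gE /radial rmorphB /= g2.
by rewrite rmorphM /= tZ mul0r subr0.
Qed.

(** The fields [line_syzygy a] remove the radial part on each line a in turn, as
    the radial part of one of them vanishes on the other lines. The rest is a
    multiple of the product of the lines with a coefficient in the ideal (x, z),
    which the rotation and the torus produce. *)
Lemma family_generates g : jacobian_syzygy f g ->
  exists (c0 c1 c2 : S) (c : K -> S),
    g = c0 *: vertical_syzygy us sl + c1 *: rotation_syzygy + c2 *: torus_syzygy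
        + \sum_(a <- sl) c a *: line_syzygy a.
Proof.
move=> gs.
have [b bP] : exists b : K -> S, forall a, a \in sl ->
    divides (line a) (radial g - b a * cofactor_line us sl a).
  suff /choice[b bP] : forall a, exists c, a \in sl ->
      divides (line a) (radial g - c * cofactor_line us sl a) by exists b.
  move=> a.
  have [ain|_] := boolP (a \in sl); last by exists 0.
  by have [c cP] := radial_on_line char0 us_nz us_uniq us_det sl_uniq sl_nz gp gs ain; exists c.
have [i iP] : exists i : K -> S, forall a, a \in sl -> i a * (d%:R%:MP * a%:MP) = 1.
  suff /choice[i iP] : forall a, exists c : S,
      a \in sl -> c * (d%:R%:MP * a%:MP) = 1 by exists i.
  move=> a.
  have [/sl_nz/d_inv[D DE]|_] := boolP (a \in sl); last by exists 0.
  by exists D.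
pose c a := i a * b a.
pose g1 := g - \sum_(a <- sl) c a *: line_syzygy a.
have g1s : jacobian_syzygy f g1.
  rewrite /g1 -scaleN1r; apply: syzygyD => //; apply: syzygyZ.
  rewrite big_seq; apply: big_ind => //; [|exact: syzygyD|].
    by rewrite /jacobian_syzygy big1 // => j _; rewrite mxE mul0r.
  by move=> a ain; apply/syzygyZ/line_syzygyP.
have g1r : radial g1 = radial g - \sum_(a <- sl) b a * cofactor_line us sl a.
  rewrite radialB radial_sum; congr (_ - _); rewrite big_seq [RHS]big_seq.
  apply: eq_bigr => a ain; rewrite radialZ radial_line /c.
  transitivity (i a * (d%:R%:MP * a%:MP) * (b a * cofactor_line us sl a)); first by ring.
  by rewrite iP // mul1r.
have g1l : {in sl, forall a, divides (line a) (radial g1)}.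
  move=> a ain; rewrite g1r (bigD1_seq a) //= opprD addrA.
  apply: dividesB; first exact: bP.
  apply: divides_sum => a' a'in ne; apply: divides_mull.
  by apply: line_divides_cofactor; rewrite // eq_sym.
have [r rE] := lines_divide_radial g1s g1l.
have [rx [rz rxz]] := tangency_ideal g1s rE.
have [D4 D4E] := d_inv (char0 3); have [D2 D2E] := d_inv (char0 1).
pose g2 := g1 + (- (rx * D4)) *: rotation_syzygy + (rz * D2) *: torus_syzygy.
have g2s : jacobian_syzygy f g2.
  apply: syzygyD; last exact/syzygyZ/torus_syzygyP.
  by apply: syzygyD => //; exact/syzygyZ/rotation_syzygyP.
have [|c0 c0E] := radial_eq0 char0 us_nz us_uniq us_det sl_uniq sl_nz g2s.
  rewrite /g2 radial_comb rE rxz radial_rotation radial_torus.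
  transitivity ((Y * other_lines) * (rx * X * (1 - D4 * (d%:R%:MP * 4%:R%:MP))
     + rz * Z * (1 - D2 * (d%:R%:MP * 2%:R%:MP)))); first by ring.
  by rewrite D4E D2E subrr !mulr0 addr0 mulr0.
exists c0, (rx * D4), (- (rz * D2)), c.
rewrite -c0E /g2 /g1 !scaleNr; set A := \sum_(a <- sl) _.
move: (_ *: rotation_syzygy) (_ *: torus_syzygy) => B C.
by rewrite [_ + C + B]addrAC subrK addrK subrK.
Qed.

End Family.

(** * Minimality of the generators *)

Section Relations.

Variable K : closedFieldType.
Local Notation S := {mpoly K[3]}.

(** This is the component of degree l of the relation. *)
Lemma constant_relation (I : Type) (s : seq I) (c p : I -> S) l :
  (forall x, p x \is l.-homog) -> \sum_(x <- s) c x * p x = 0 ->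
  \sum_(x <- s) ((c x)@_0%MM)%:MP * p x = 0.
Proof.
move=> hp e; apply/mpolyP => m; rewrite mcoeff0 raddf_sum /=.
have [ml|ml] := leqP (mdeg m) l.
  have := congr1 (mcoeff m) e; rewrite mcoeff0 raddf_sum /= => em.
  rewrite -[RHS]em.
  by apply: eq_bigr => x _; rewrite mcoeffCM (mcoeffM_homog _ (hp x) ml).
rewrite big1 // => x _; rewrite mcoeffCM (dhomog_nemf_coeff (hp x)) ?mulr0 //=.
by rewrite gtn_eqF.
Qed.

Lemma sum_three_and_map (T : eqType) (x0 : T) (s : seq T) (F : T -> 'rV[S]_3)
    (v0 v1 v2 : 'rV[S]_3) (c : nat -> S) : uniq s ->
  \sum_(0 <= i < (size s).+3) c i *: ([:: v0; v1; v2] ++ [seq F x | x <- s])`_i =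
  c 0%N *: v0 + c 1%N *: v1 + c 2%N *: v2
  + \sum_(x <- s) c (index x s).+3 *: F x.
Proof.
move=> us; rewrite !big_nat_recl //= !addrA; congr (_ + _).
rewrite [RHS](big_nth x0) !big_nat; apply: eq_bigr => i /= ilt.
by rewrite (nth_map x0) // index_uniq.
Qed.

End Relations.

Section FamilyType.

Variable K : closedFieldType.
Hypothesis char0 : forall n, n.+1%:R != 0 :> K.
Local Notation S := {mpoly K[3]}.
Local Notation X := ('X_o0 : S).
Local Notation Y := ('X_o1 : S).
Local Notation Z := ('X_o2 : S).

Variables (ws : seq (K * K)) (sl : seq K).
Implicit Types (a b : K) (u v : K * K) (g h : 'rV[S]_3).
Local Notation us := ((1, 0) :: ws).
Local Notation f := (config us sl).
Local Notation d := (2 + (size sl + size us))%N.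
Local Notation k := (size sl + size ws)%N.
Hypothesis us_nz : {in us, forall u, u != (0, 0)}.
Hypothesis us_uniq : uniq us.
Hypothesis us_det : {in us &, forall u v, u != v -> det2 u v != 0}.
Hypothesis sl_uniq : uniq sl.
Hypothesis sl_nz : {in sl, forall a, a != 0}.
Hypothesis us_fst : {in us, forall u, u.1 != 0}.
Hypothesis gp : general_position us sl.
Let ok := comps_ok char0 us_nz us_uniq us_det sl_uniq sl_nz.

(** Line a divides all terms except the one of index a. The terms in x and z
    remain. *)
Lemma family_radials_independent (c1 c2 : K) (c : K -> K) :
  c1%:MP * (4%:R%:MP * X * (Y * other_lines ws sl))
  + c2%:MP * (- (2%:R%:MP * Z * (Y * other_lines ws sl)))
  + \sum_(a <- sl) (c a)%:MP * (a%:MP * cofactor_line us sl a) = 0 ->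
  [/\ c1 = 0, c2 = 0 & forall a, a \in sl -> c a = 0].
Proof.
set L := Y * other_lines ws sl => e.
have ca a : a \in sl -> c a = 0.
  move=> ain; apply/eqP/negPn/negP => ca0.
  have la : divides (line a) L by apply/divides_mull/line_divides_other.
  apply: (line_ndivides_cofactor char0 us_nz us_uniq us_det sl_uniq sl_nz ain).
  apply: (divides_constl (sl_nz ain)); apply: (divides_constl ca0).
  move: e; rewrite (bigD1_seq a) //= addrCA => /eqP.
  rewrite addr_eq0 => /eqP ->.
  apply/dividesN; rewrite -addrA; apply: dividesD.
    exact/divides_mull/divides_mull.
  apply: dividesD; first exact/divides_mull/dividesN/divides_mull.
  apply: divides_sum => b bin ne; apply/divides_mull/divides_mull.
  by apply: line_divides_cofactor; rewrite // eq_sym.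
have L0 : L != 0.
  have := config_neq0 char0 us_nz us_uniq us_det sl_uniq sl_nz.
  by rewrite configE mulf_eq0 negb_or => /andP[].
have e' : (c1 * 4%:R)%:MP * X - (c2 * 2%:R)%:MP * Z = 0 :> S.
  apply: (mulIf L0); rewrite mul0r -e big_seq big1 => [|a ain].
    by rewrite !mpolyCM; ring.
  by rewrite ca // mpolyC0 mul0r.
have ev := congr1 (fun p : S => p.@[pt _ _ _]) e'.
have := ev 1 0 0; have := ev 0 0 1.
rewrite !meval0 !mevalB !mevalM !mevalC !mevalXU /pt /= !mulr0 !mulr1 sub0r subr0.
move=> /eqP; rewrite oppr_eq0 mulf_eq0 (negPf (char0 1)) orbF => /eqP c20.
move=> /eqP; rewrite mulf_eq0 (negPf (char0 3)) orbF => /eqP c10.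
by split.
Qed.

Definition family_generators : seq 'rV[S]_3 :=
  [:: vertical_syzygy us sl; rotation_syzygy ws sl; torus_syzygy ws sl] ++
  [seq line_syzygy ws sl a | a <- sl].

Definition family_degrees : seq nat :=
  [:: (2 + size sl)%N, k.+1, k.+1 & nseq (size sl) k.+1].

Lemma size_family_degrees : size family_degrees = (size sl).+3.
Proof. by rewrite /= size_nseq. Qed.

Lemma family_generators_sum (c : nat -> S) :
  \sum_(0 <= i < size family_degrees) c i *: family_generators`_i =
  c 0%N *: vertical_syzygy us sl + c 1%N *: rotation_syzygy ws sl
  + c 2%N *: torus_syzygy ws sl
  + \sum_(a <- sl) c (index a sl).+3 *: line_syzygy ws sl a.
Proof.
by rewrite size_family_degrees; exact: (sum_three_and_map 0).
Qed.

Lemma family_generators_syzygy i : jacobian_syzygy f family_generators`_i.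
Proof.
have syz0 : jacobian_syzygy f 0.
  by rewrite /jacobian_syzygy big1 // => j _; rewrite mxE mul0r.
have [ilt|/(nth_default 0) -> //] := ltnP i (size family_generators).
move/(mem_nth 0): ilt; rewrite mem_cat !inE => /orP[/or3P[]/eqP ->|/mapP[a ain ->]].
- exact: vertical_syzygyP.
- exact: rotation_syzygyP.
- exact: torus_syzygyP.
exact: line_syzygyP.
Qed.

Lemma family_generators_homog i :
  homogeneous_of_degree (nth 0%N family_degrees i) family_generators`_i.
Proof.
case: i => [|[|[|i]]].
- exact: vertical_syzygy_homog.
- exact: rotation_syzygy_homog.
- exact: torus_syzygy_homog.
change (homogeneous_of_degree (nth 0%N (nseq (size sl) k.+1) i)
  [seq line_syzygy ws sl a | a <- sl]`_i).
have [ilt|ile] := ltnP i (size sl); last first.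
  by rewrite [X in homogeneous_of_degree _ X]nth_default ?size_map // => j;
    rewrite mxE rpred0.
rewrite nth_nseq ilt (nth_map 0) //.
by apply: line_syzygy_homog => //; exact: mem_nth.
Qed.

(** The radial part kills the first generator, and those of the others are
    linearly independent of the same degree. *)
Lemma other_generators_constant_term (c : nat -> S) :
  \sum_(0 <= i < size family_degrees) c i *: family_generators`_i = 0 ->
  forall i, (0 < i < size family_degrees)%N -> (c i)@_0%MM = 0.
Proof.
rewrite family_generators_sum => e.
have Lh : Y * other_lines ws sl \is k.+1.-homog.
  exact: (dhomogM (X_homog K o1) (other_lines_homog ws sl)).
(* P x is the radial part of the generator of index x + 1, divided by d. *)
pose P (x : nat) : S := match x with
  | 0%N => 4%:R%:MP * X * (Y * other_lines ws sl)
  | 1%N => - (2%:R%:MP * Z * (Y * other_lines ws sl))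
  | j.+2 => if (j < size sl)%N then (sl`_j)%:MP * cofactor_line us sl sl`_j else 0 end.
have Ph x : P x \is k.+2.-homog.
  case: x => [|[|j]] /=.
  - exact: (dhomogM (CX_homog _ _) Lh).
  - rewrite rpredN; exact: (dhomogM (CX_homog _ _) Lh).
  case: ifP => jlt; last exact: rpred0.
  have hF := line_factor_homog ws sl_uniq (mem_nth 0 jlt); rewrite cofactor_lineE.
  exact: (dhomogM (C_homog _) (dhomogM (X_homog K o1) hF)).
have PE (b : nat -> S) : \sum_(0 <= x < (size sl).+2) b x * P x =
    b 0%N * (4%:R%:MP * X * (Y * other_lines ws sl))
    + b 1%N * (- (2%:R%:MP * Z * (Y * other_lines ws sl)))
    + \sum_(a <- sl) b (index a sl).+2 * (a%:MP * cofactor_line us sl a).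
  rewrite !big_nat_recl //= addrA; congr (_ + _).
  rewrite [RHS](big_nth 0) !big_nat; apply: eq_bigr => i /= ilt.
  by rewrite ilt index_uniq.
have rel : \sum_(0 <= x < (size sl).+2) c x.+1 * P x = 0.
  have dn0 : d%:R%:MP != 0 :> S by rewrite mpolyC_eq0 char0.
  apply: (mulfI dn0); rewrite mulr0 PE.
  have := congr1 (@radial K) e.
  rewrite radialD radial_comb (radialZ (c 0%N)) radial_vertical.
  rewrite radial_rotation radial_torus radial_sum.
  rewrite [X in _ = X -> _]/radial !mxE !mulr0 subrr add0r => {}e.
  rewrite -[RHS]e !mulrDr mulr_sumr; congr (_ + _ + _); last first.
    by apply: eq_bigr => a _; rewrite radialZ radial_line mulrCA.
    by rewrite mulrCA.
  by rewrite mulrCA.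
have := constant_relation Ph rel.
rewrite (PE (fun x => ((c x.+1)@_0%MM)%:MP)) => /family_radials_independent.
case=> c1 c2 ca [|[|[|i]]] //= ilt.
have {}ilt : (i < size sl)%N by move: ilt; rewrite size_nseq.
by have := ca _ (mem_nth 0 ilt); rewrite index_uniq.
Qed.

(** In the degree of the first generator, which is at most that of the others,
    a relation only involves the constant terms of its coefficients. *)
Lemma generators_constant_term (c : nat -> S) : (0 < size ws)%N ->
  \sum_(0 <= i < size family_degrees) c i *: family_generators`_i = 0 ->
  forall i, (i < size family_degrees)%N -> (c i)@_0%MM = 0.
Proof.
move=> wpos e [|i] ilt; last exact: (other_generators_constant_term e).
have oth := other_generators_constant_term e.
have Ghom := family_generators_homog.
have G0 : family_generators`_0 = vertical_syzygy us sl by [].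
move: family_generators e Ghom G0 => G e Ghom G0.
have V0 : vertical_syzygy us sl != 0.
  apply/eqP => z.
  have := @vertical_torsionfree _ char0 _ _ us_nz us_uniq us_det sl_uniq sl_nz 1.
  by rewrite z scaler0 => /(_ erefl) /eqP; rewrite oner_eq0.
have /existsP[j Vj] : [exists j, vertical_syzygy us sl 0 j != 0].
  apply: contraNT V0 => /existsPn uz; apply/eqP/rowP => j.
  by rewrite [RHS]mxE; apply/eqP/negPn/uz.
set V := vertical_syzygy us sl 0 j in Vj.
have hV : V \is (2 + size sl).-homog by exact: vertical_syzygy_homog.
have md := dhomog_mf hV (mlead_supp Vj).
move/(congr1 (fun g : 'rV[S]_3 => (g 0 j)@_(mlead V))): e.
rewrite mxE mcoeff0 summxE raddf_sum /= big_nat_recl //= big_nat big1 => [|l /= lt].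
  rewrite G0 mxE -/V addr0 (mcoeffM_homog _ hV) ?md // => /eqP.
  by rewrite mulf_eq0 -/(mleadc V) mleadc_eq0 (negPf Vj) orbF => /eqP.
rewrite mxE (mcoeffM_homog _ (Ghom l.+1 j)); first by rewrite oth ?mul0r.
have -> : nth 0%N family_degrees l.+1 = k.+1.
  move: lt; case: l => [|[|l]] //= lt; rewrite nth_nseq.
  by move: lt; rewrite size_nseq !ltnS => ->.
by rewrite md; move: wpos; lia.
Qed.

Lemma family_type : (0 < size ws)%N -> has_type f ((size sl).+1)%:Z.
Proof.
move=> wpos; exists (2 + size sl)%N, k.+1; split; last first.
  rewrite /type_of_degrees (curve_degree_config char0 us_nz us_uniq us_det sl_uniq sl_nz) /=.
  lia.
exists (k.+1 :: nseq (size sl) k.+1); rewrite -/family_degrees; split.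
  have constant_sorted n m : path leq m (nseq n m).
    by elim: n => //= n IH; rewrite leqnn.
  by rewrite /sorted /= constant_sorted ?leqnn ?andbT; move: wpos; lia.
pose G (i : 'I_(size family_degrees)) := family_generators`_i.
have GE (c : nat -> S) : \sum_(i < size family_degrees) c i *: G i =
    \sum_(0 <= i < size family_degrees) c i *: family_generators`_i.
  by rewrite big_mkord.
have Gs i : jacobian_syzygy f (G i) by exact: family_generators_syzygy.
exists G; split=> //.
- by move=> i; exact: family_generators_homog.
- move=> g /(family_generates char0 us_nz us_uniq us_det sl_uniq sl_nz us_fst gp).
  case=> c0 [c1 [c2 [c ->]]].
  exists (fun i => [:: c0, c1, c2 & [seq c a | a <- sl]]`_i).
  under [RHS]eq_bigl => i do rewrite in_setT.
  rewrite (GE (fun i => [:: c0, c1, c2 & [seq c a | a <- sl]]`_i)).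
  rewrite family_generators_sum /=; congr (_ + _).
  rewrite !big_seq; apply: eq_bigr => a ain.
  by rewrite (nth_map 0) ?nth_index ?index_mem.
apply: irredundant_generators => // c e i.
pose c' (n : nat) := oapp c 0 (insub n).
have c'E (l : 'I_(size family_degrees)) : c' l = c l by rewrite /c' valK.
rewrite -c'E; apply: generators_constant_term => //.
by rewrite -GE -[RHS]e; apply: eq_bigr => l _; rewrite c'E.
Qed.

End FamilyType.

(** * Choice of the parameters *)

Section Existence.

Variable K : closedFieldType.
Hypothesis char0 : forall n, n.+1%:R != 0 :> K.
Local Notation S := {mpoly K[3]}.
Local Notation X := ('X_o0 : S).
Local Notation Y := ('X_o1 : S).
Local Notation Z := ('X_o2 : S).

Lemma natr_inj (m n : nat) : m%:R = n%:R :> K -> m = n.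
Proof.
wlog le : m n / (m <= n)%N.
  move=> wl e; have [le|/ltnW le] := leqP m n; first exact: wl.
  by apply/esym/wl.
move=> e; apply/eqP; rewrite eqn_leq le -subn_eq0.
have : (n - m)%:R = 0 :> K by rewrite natrB // e subrr.
by case: (n - m)%N => // l /eqP; rewrite (negPf (char0 l)).
Qed.

(** Here the vertical syzygy is a combination of the rotation and of the torus,
    which form a basis. *)
Lemma conic_tangent_free :
  has_type (config [:: (1, 0)] (@nil K)) 0 /\ free_curve (config [:: (1, 0)] (@nil K)).
Proof.
pose us : seq (K * K) := [:: (1, 0)]; pose sl : seq K := [::].
have us_nz : {in us, forall u, u != (0, 0)}.
  by move=> u; rewrite inE => /eqP ->; rewrite xpair_eqE negb_and oner_eq0.
have us_uniq : uniq us by [].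
have us_det : {in us &, forall u v, u != v -> det2 u v != 0}.
  by move=> u v; rewrite !inE => /eqP -> /eqP ->; rewrite eqxx.
have sl_uniq : uniq sl by [].
have sl_nz : {in sl, forall a, a != 0} by [].
have us_fst : {in us, forall u, u.1 != 0}.
  by move=> u; rewrite inE => /eqP -> /=; rewrite oner_eq0.
have gp : general_position us sl by split.
have o1E : other_lines [::] sl = 1 by rewrite /other_lines /line_part /other_pencil !big_nil mulr1.
have der1 g : der g (1 : S) = 0 by rewrite -mpolyC1 derC.
have three : (3%:R : K)%:MP = 1 + 1 + 1 :> S.
  by rewrite mpolyC_nat; ring.
have four : (4%:R : K)%:MP = 1 + 1 + 1 + 1 :> S.
  by rewrite mpolyC_nat; ring.
have two : (2%:R : K)%:MP = 1 + 1 :> S.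
  by rewrite mpolyC_nat; ring.
have dE : (2 + (size sl + size us))%N = 3%N by [].
have rotE : rotation_syzygy [::] sl = vec (- (3%:R%:MP * Y)) 0 (3%:R%:MP * (4%:R%:MP * X)).
  rewrite /rotation_syzygy o1E der1 scale1r /syzygy_of scale0r subr0 dE.
  by apply: row3P; rewrite mxE /rotation_der !vecE; ring.
have torE : torus_syzygy [::] sl = vec (- X) (2%:R%:MP * Y) (- (4%:R%:MP * Z)).
  rewrite /torus_syzygy o1E der1 scale1r /syzygy_of dE.
  by apply: row3P; rewrite !mxE /= ?three ?four ?two; ring.
have vertE : vertical_syzygy us sl =
    (- Z) *: rotation_syzygy [::] sl + (- (2%:R%:MP * X)) *: torus_syzygy [::] sl.
  rewrite rotE torE /vertical_syzygy /syzygy_of dE.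
  have TE : transversal_part sl = conic K by rewrite /transversal_part /line_part big_nil mulr1.
  have dT : mderiv o0 (conic K) = 4%:R%:MP * X.
    by rewrite -[LHS]mul1r -der_vertical der_conic !vecE; ring.
  rewrite TE dT.
  by apply: row3P; rewrite !mxE /= /conic ?three ?four ?two; ring.
have [] := @homogeneous_basis K (config us sl) (rotation_syzygy [::] sl)
  (torus_syzygy [::] sl) 1 1.
- exact: rotation_syzygyP.
- exact: torus_syzygyP.
- exact: rotation_syzygy_homog.
- exact: torus_syzygy_homog.
- move=> g /(family_generates char0 us_nz us_uniq us_det sl_uniq sl_nz us_fst gp).
  case=> c0 [c1 [c2 [c ->]]]; rewrite big_nil addr0 vertE.
  exists (c1 - c0 * Z), (c2 - c0 * (2%:R%:MP * X)).
  move: (rotation_syzygy _ _) (torus_syzygy _ _) => G H.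
  by apply/rowP => j; rewrite !mxE; ring.
- move=> a b ab0.
  have := congr1 (fun g : 'rV[S]_3 => g 0 o1) ab0; rewrite rotE torE !mxE /=.
  rewrite mulr0 add0r => /eqP; rewrite !mulf_eq0 mpolyC_eq0 (negPf (char0 1)).
  rewrite (negPf (X_neq0 K o1)) !orbF => /eqP b0; split=> //.
  have := congr1 (fun g : 'rV[S]_3 => g 0 o2) ab0; rewrite rotE torE !mxE /= b0 mul0r.
  rewrite addr0 => /eqP; rewrite !mulf_eq0 !mpolyC_eq0 (negPf (char0 2)) (negPf (char0 3)).
  by rewrite (negPf (X_neq0 K o0)) !orbF => /eqP.
move=> ht hf; split=> //; move: ht.
by rewrite (curve_degree_config char0 us_nz us_uniq us_det sl_uniq sl_nz).
Qed.

(** The line y = j z; the index 0 gives the tangent y = 0 of the conic. *)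
Definition pencil_slope (j : nat) : K * K := (1, - j%:R).

Lemma pencil_slope_det i j : i != j -> det2 (pencil_slope i) (pencil_slope j) != 0.
Proof.
apply: contraNneq => e; apply/eqP/natr_inj/eqP; rewrite -subr_eq0 -e /det2 /=.
apply/eqP; ring.
Qed.

Lemma pencil_slope_inj : injective pencil_slope.
Proof. by move=> i j [/oppr_inj/natr_inj]. Qed.

Lemma pencil_slope0 : pencil_slope 0 = (1, 0).
Proof. by rewrite /pencil_slope oppr0. Qed.

Definition slopes n : seq K := [seq j.+1%:R | j <- iota 0 n].

Lemma slopes_uniq n : uniq (slopes n).
Proof. by rewrite map_inj_uniq ?iota_uniq // => i j /natr_inj []. Qed.

Lemma slopes_nz n : {in slopes n, forall a, a != 0}.
Proof. by move=> a /mapP[j _ ->]. Qed.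

Section PencilSlopes.

Variable s : seq nat.
Hypothesis s_uniq : uniq s.
Local Notation us := (map pencil_slope s).

Lemma pencil_slopes_fst : {in us, forall u, u.1 != 0}.
Proof. by move=> u /mapP[j _ ->] /=; rewrite oner_eq0. Qed.

Lemma pencil_slopes_nz : {in us, forall u, u != (0, 0)}.
Proof. by move=> u /pencil_slopes_fst; apply: contraNneq => ->. Qed.

Lemma pencil_slopes_uniq : uniq us.
Proof. by rewrite map_inj_uniq //; exact: pencil_slope_inj. Qed.

Lemma pencil_slopes_det : {in us &, forall u v, u != v -> det2 u v != 0}.
Proof.
move=> u v /mapP[i _ ->] /mapP[j _ ->] ij; apply: pencil_slope_det.
by apply: contraNneq ij => ->.
Qed.

(** Signs settle the first conditions. The last one is a b l != 1 for a natural number l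
    and distinct positive integers a and b. *)
Lemma slopes_general_position n : general_position us (slopes n).
Proof.
split.
- move=> a b /mapP[i _ ->] /mapP[j _ ->].
  by rewrite -natrM -natrD addnS char0.
- move=> a u /mapP[i _ ->] /mapP[j _ ->] /=; rewrite !mulrN !opprK; split.
    by rewrite mulr1 -natrX -natrM -natrD addSn char0.
  by rewrite -natrX -!natrM addrC natr1 char0.
move=> a b u /mapP[i _ ->] /mapP[j _ ->] /mapP[l _ ->] /= ij.
rewrite mulrN -!natrM subr_eq0; apply/eqP => /(@natr_inj 1) /esym/eqP.
rewrite !muln_eq1 => /andP[/andP[/eqP[i0] /eqP[j0]] _].
by rewrite i0 j0 eqxx in ij.
Qed.

End PencilSlopes.

Lemma config_arrangement us sl :
  {in us, forall u, u != (0, 0)} -> uniq us ->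
  {in us &, forall u v, u != v -> det2 u v != 0} ->
  uniq sl -> {in sl, forall a, a != 0} ->
  exists A : conic_line_arrangement K,
    [/\ has_conic A, equation A = config us sl &
        curve_degree (equation A) = (2 + (size sl + size us))%N].
Proof.
move=> us_nz us_uniq us_det sl_uniq sl_nz.
have [A [AE Ac]] := arrangement_of_seq (comps_ok char0 us_nz us_uniq us_det sl_uniq sl_nz).
exists A; split=> //; last by rewrite AE; exact: curve_degree_config.
have [i iE] := Ac _ (conic_in_comps us sl).
by exists i; rewrite iE; exact: conic_is_smooth.
Qed.

Lemma exists_free d : (3 <= d)%N -> exists A : conic_line_arrangement K,
  [/\ has_conic A, has_type (equation A) 0, free_curve (equation A) &
      curve_degree (equation A) = d].
Proof.
have nil_nz : {in @nil K, forall a, a != 0} by [].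
case: d => [|[|[|[|d]]]] // _.
  have us0 : [:: (1, 0)] = map pencil_slope [:: 0%N] by rewrite /= pencil_slope0.
  have [] := @config_arrangement [:: (1, 0)] [::] _ _ _ _ nil_nz; rewrite ?us0 //.
  - exact: pencil_slopes_nz.
  - exact: pencil_slopes_det.
  rewrite -us0 => A [Ac AE Ad]; exists A; rewrite Ad AE.
  by have [] := conic_tangent_free; split.
pose ws := map pencil_slope (iota 1 d); pose us : seq (K * K) := (1, 0) :: (0, 1) :: ws.
pose ws0 := map pencil_slope (iota 0 d.+1).
have ws0E : ws0 = (1, 0) :: ws by rewrite /ws0 /= pencil_slope0.
have us_in u : u \in us -> u = (0, 1) \/ u \in ws0.
  by rewrite ws0E /us !inE => /or3P[->|/eqP ->|->]; rewrite ?orbT; [right|left|right].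
have vert u : u \in ws0 -> det2 u (0, 1) != 0.
  by move=> /mapP[j _ ->]; rewrite /det2 /= mulr0 subr0 mulr1 oner_eq0.
have us_nz : {in us, forall u, u != (0, 0)}.
  move=> u /us_in[->|/pencil_slopes_nz //].
  by rewrite xpair_eqE negb_and oner_eq0 orbT.
have us_det : {in us &, forall u v, u != v -> det2 u v != 0}.
  move=> u v /us_in[->|uin] /us_in[->|vin]; rewrite ?eqxx //.
  - by rewrite det2C oppr_eq0 vert.
  - by rewrite vert.
  exact: (pencil_slopes_det uin vin).
have us_uniq : uniq us.
  have : uniq ws0 by rewrite pencil_slopes_uniq ?iota_uniq.
  rewrite ws0E /us !cons_uniq => /andP[n1 ->]; rewrite inE negb_or n1 !andbT.
  rewrite xpair_eqE oner_eq0 /=; apply/negP => w0.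
  by have := vert (0, 1); rewrite ws0E inE w0 orbT /det2 /= => /(_ isT); rewrite mul0r mulr0 subrr eqxx.
have [A [Ac AE Ad]] := config_arrangement us_nz us_uniq us_det (isT : uniq (@nil K)) nil_nz.
exists A; rewrite Ad AE /= size_map size_iota.
by have [] := free_family_free char0 us_nz us_uniq us_det; split.
Qed.

Lemma exists_type n w : (0 < w)%N -> exists A : conic_line_arrangement K,
  [/\ has_conic A, has_type (equation A) n.+1%:Z &
      curve_degree (equation A) = (n + w + 3)%N].
Proof.
move=> wpos; pose us := map pencil_slope (iota 0 w.+1).
have usE : us = (1, 0) :: map pencil_slope (iota 1 w) by rewrite /us /= pencil_slope0.
have us_nz : {in us, forall u, u != (0, 0)} by exact: pencil_slopes_nz.
have us_fst : {in us, forall u, u.1 != 0} by exact: pencil_slopes_fst.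
have us_uniq : uniq us by rewrite pencil_slopes_uniq ?iota_uniq.
have us_det : {in us &, forall u v, u != v -> det2 u v != 0} by exact: pencil_slopes_det.
have gp : general_position us (slopes n) by exact: slopes_general_position.
have [A [Ac AE Ad]] := config_arrangement us_nz us_uniq us_det (slopes_uniq n) (@slopes_nz n).
exists A; split=> //; last first.
  by rewrite Ad /us !size_map !size_iota; lia.
have ->: n = size (slopes n) by rewrite size_map size_iota.
rewrite AE; move: us_nz us_uniq us_det us_fst gp; rewrite usE => *.
apply: (family_type char0) => //; [exact: slopes_uniq | exact: slopes_nz |].
by rewrite size_map size_iota.
Qed.

End Existence.

Theorem corollary1p10 (R : realType) :
  [/\ (forall (A : conic_line_arrangement R[i]) (d1 d2 : nat),
         two_smallest_degrees (equation A) d1 d2 ->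
         d2%:Z <= (curve_degree (equation A))%:Z - 2 ->
         0 <= type_of_degrees (equation A) d1 d2
           <= (curve_degree (equation A))%:Z - 3),
      (forall t d : int, 0 <= t <= d - 3 ->
         exists A : conic_line_arrangement R[i],
           [/\ has_conic A,
               has_type (equation A) t &
               (curve_degree (equation A))%:Z = d])
    & (forall d : nat, (3 <= d)%N ->
         exists A : conic_line_arrangement R[i],
           [/\ has_conic A,
               free_curve (equation A) &
               curve_degree (equation A) = d])].
Proof.
have char0 n : n.+1%:R != 0 :> R[i] by rewrite pnatr_eq0.
split.
- move=> A d1 d2 hd d2le.
  have [|lb d12] := type_bounds char0 hd.
    by move: d2le; move: (curve_degree _) => D; lia.
  by rewrite /type_of_degrees; move: lb d12 d2le; move: (curve_degree _) => D; lia.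
- move=> t d /andP[]; case: t => // -[|n] _; case: d => // d dle.
    have [|A [Ac At _ Ad]] := exists_free char0 (d := d); first by move: dle; lia.
    by exists A; rewrite Ad.
  have [|A [Ac At Ad]] := exists_type char0 n (w := (d - 3 - n)%N).
    by move: dle; lia.
  by exists A; split=> //; rewrite Ad; move: dle; lia.
move=> d /(exists_free char0)[A [Ac _ Af Ad]].
by exists A.
Qed.
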